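(* (Separation of variables.) Let $\varphi(\bar x,\bar b)$ be an instance of a stable formula $\varphi(\bar x,\bar y)$, and let $X$ be a type-definable set in the sort of $\bar x$, type-definable with parameters in a set $A$. Then there is an at most countable set $B\subseteq X$ (of realisations of $X$) and a $B$-definable predicate $\psi(\bar x)$ such that $\psi(\bar x){\restriction}_X=\varphi(\bar x,\bar b){\restriction}_X$. Moreover, $\psi(\bar x)$ can be taken to be a faithful combination of instances $\varphi(\bar x,\bar b')$ such that $\bar b'\equiv_B\bar b$, or even such that $\bar b'\equiv_{B'}\bar b$ where $B'\subseteq X$ is an arbitrary small subset.
   Context: Continuous first order logic: formulas take values in $[0,1]$; $T$ is a continuous theory; work in a monster model, and identify $X$ with its set of realisations there; ''small'' means of size less than the saturation of the monster. A definable predicate is a uniform limit of formulas with parameters. A formula is stable if it does not have the order property in any model of $T$. A faithful continuous connective in $\alpha$ variables is a continuous $\theta\colon[0,1]^\alpha\to[0,1]$ with $\inf\bar a\le\theta(\bar a)\le\sup\bar a$; a faithful combination of definable predicates $(\varphi_i)_{i<\alpha}$ is $\theta(\varphi_i)_{i<\alpha}$ for such $\theta$. *)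

(* Defs.v *)
(* Continuous (many-sorted) first order logic on top of MathComp-Analysis. *)
From HB Require Import structures.
From mathcomp Require Import all_boot all_order all_algebra.
From mathcomp Require Import all_classical all_reals all_analysis.
Set Implicit Arguments.
Unset Strict Implicit.
Unset Printing Implicit Defensive.
Import Order.TTheory GRing.Theory Num.Theory.
Import numFieldNormedType.Exports.
Local Open Scope classical_set_scope.
Local Open Scope ring_scope.
Local Open Scope card_scope.

Section Connectives.
Context {R : realType}.

Definition cube (I : Type) : set {ptws I -> R} :=
  [set a | forall i, 0 <= a i <= 1].

(* [I] is an arbitrary, possibly infinite, index set; [0,1]^I carries the
   product topology. Values outside the cube are irrelevant. *)
Record connective (I : Type) := Connective {
  conn_fun :> {ptws I -> R} -> R ;
  conn_cont : {within @cube I, continuous conn_fun} ;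
  conn_range : forall a, cube a -> 0 <= conn_fun a <= 1 }.

(* [inhabited I] is needed because the library sets [inf set0 = sup set0 = 0];
   in [0,1] one has inf 0 = 1 > 0 = sup 0, so that there is no faithful
   connective in zero variables. *)
Definition faithful (I : Type) (theta : connective I) : Prop :=
  inhabited I /\
  forall a, cube a -> inf (range a) <= theta a <= sup (range a).

End Connectives.
Arguments connective R I : clear implicits.

Record language (R : realType) := Language {
  lsort : Type ;
  fsym : Type ;
  farity : fsym -> nat ;
  fdom : forall f : fsym, 'I_(farity f) -> lsort ;
  fcod : fsym -> lsort ;
  fmod : fsym -> R -> R ;
  fmod_gt0 : forall f e, 0 < e -> 0 < fmod f e ;
  psym : Type ;
  parity : psym -> nat ;
  pdom : forall p : psym, 'I_(parity p) -> lsort ;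
  pmod : psym -> R -> R ;
  pmod_gt0 : forall p e, 0 < e -> 0 < pmod p e }.

Section Syntax.
Context {R : realType} {L : language R}.

(* A context is a type [V] of variables with a sort assignment. *)
Definition ctx_ext (V : Type) (s : lsort L) (sv : V -> lsort L) :
    option V -> lsort L :=
  fun o => match o with Some v => sv v | None => s end.

Definition ctx_sum (V W : Type) (sv : V -> lsort L) (sw : W -> lsort L) :
    V + W -> lsort L :=
  fun z => match z with inl v => sv v | inr w => sw w end.

Inductive term (V : Type) (sv : V -> lsort L) : lsort L -> Type :=
| Var v : term sv (sv v)
| App f : (forall k : 'I_(farity f), term sv (fdom k)) -> term sv (fcod f).

Inductive formula (V : Type) (sv : V -> lsort L) : Type :=
| Dist s : term sv s -> term sv s -> formula sv
| Pred p : (forall k : 'I_(parity p), term sv (pdom k)) -> formula sv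
| Conn n : connective R 'I_n -> ('I_n -> formula sv) -> formula sv
| Sup s : formula (ctx_ext s sv) -> formula sv
| Inf s : formula (ctx_ext s sv) -> formula sv.

Definition no_var : void -> lsort L := fun v => match v with end.

Definition sentence := formula no_var.

End Syntax.
Arguments sentence {R} L.

Record structure (R : realType) (L : language R) := Structure {
  carrier :> lsort L -> metricType R ;
  carrier_inh : forall s, inhabited (carrier s) ;
  carrier_diam : forall s (x y : carrier s), mdist x y <= 1 ;
  carrier_complete : forall s (F : set_system (carrier s)),
    ProperFilter F -> cauchy F -> exists x : carrier s, F --> x ;
  fint : forall f : fsym L,
    (forall k : 'I_(farity f), carrier (fdom k)) -> carrier (fcod f) ;
  fint_unif : forall (f : fsym L) (x y : forall k, carrier (@fdom _ L f k)) e,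
    0 < e -> (forall k, mdist (x k) (y k) < fmod f e) ->
    mdist (fint x) (fint y) <= e ;
  pint : forall p : psym L, (forall k : 'I_(parity p), carrier (pdom k)) -> R ;
  pint_range : forall (p : psym L) (x : forall k, carrier (@pdom _ L p k)),
    0 <= pint x <= 1 ;
  pint_unif : forall (p : psym L) (x y : forall k, carrier (@pdom _ L p k)) e,
    0 < e -> (forall k, mdist (x k) (y k) < pmod p e) ->
    `|pint x - pint y| <= e }.

Section Semantics.
Context {R : realType} {L : language R} (M : structure L).

(* The elements of the sort of a tuple of variables (also: assignments). *)
Definition mtuple (V : Type) (sv : V -> lsort L) := forall v, M (sv v).

Definition mtuple_ext V (sv : V -> lsort L) s (a : M s) (e : mtuple sv) :
    mtuple (ctx_ext s sv) :=
  fun o => match o with Some v => e v | None => a end.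

Definition mtuple_sum V W (sv : V -> lsort L) (sw : W -> lsort L)
    (e : mtuple sv) (f : mtuple sw) : mtuple (ctx_sum sv sw) :=
  fun z => match z with inl v => e v | inr w => f w end.

Fixpoint teval V (sv : V -> lsort L) s (t : term sv s) (e : mtuple sv) : M s :=
  match t with
  | Var v => e v
  | App f ts => fint (fun k => teval (ts k) e)
  end.

Fixpoint feval V (sv : V -> lsort L) (phi : formula sv) (e : mtuple sv) : R :=
  match phi with
  | Dist s t u => mdist (teval t e) (teval u e)
  | Pred p ts => pint (fun k => teval (ts k) e)
  | Conn n c ps => c (fun k => feval (ps k) e)
  | Sup s psi => sup (range (fun a : M s => feval psi (mtuple_ext a e)))
  | Inf s psi => inf (range (fun a : M s => feval psi (mtuple_ext a e)))
  end.

Definition no_mtuple : mtuple no_var := fun v => match v with end.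

(* A theory is a set of sentences [chi], standing for conditions chi = 0. *)
Definition models (T : set (sentence L)) : Prop :=
  forall chi, T chi -> feval chi no_mtuple = 0.

Definition order_property V W (sv : V -> lsort L) (sw : W -> lsort L)
    (phi : formula (ctx_sum sv sw)) : Prop :=
  exists (eps : R) (a : nat -> mtuple sv) (b : nat -> mtuple sw), 0 < eps /\
    forall i j, (i < j)%N ->
      eps <= `|feval phi (mtuple_sum (a i) (b j)) -
               feval phi (mtuple_sum (a j) (b i))|.

(* Formulas with parameters: sets of parameters are sets of elements of
   arbitrary sorts, and the parameters are used as extra variables that are
   then assigned to themselves. *)
Definition elt := {s : lsort L & M s}.

Definition par_sort (A : set elt) (p : {p : elt | A p}) : lsort L :=
  projT1 (sval p).

Definition par_mtuple (A : set elt) : mtuple (@par_sort A) :=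
  fun p => projT2 (sval p).

Definition pformula (A : set elt) V (sv : V -> lsort L) :=
  formula (ctx_sum sv (@par_sort A)).

Definition peval (A : set elt) V (sv : V -> lsort L) (phi : pformula A sv)
    (a : mtuple sv) : R :=
  feval phi (mtuple_sum a (@par_mtuple A)).

Definition coords V (sv : V -> lsort L) (B : set (mtuple sv)) : set elt :=
  [set p | exists2 c, B c & exists v, p = existT _ (sv v) (c v)].

Definition realises (A : set elt) V (sv : V -> lsort L)
    (P : set (pformula A sv)) : set (mtuple sv) :=
  [set a | forall chi, P chi -> peval chi a = 0].

Definition type_definable (A : set elt) V (sv : V -> lsort L)
    (X : set (mtuple sv)) : Prop :=
  exists P : set (pformula A sv), X = realises P.

Definition definable_predicate (A : set elt) V (sv : V -> lsort L)
    (psi : mtuple sv -> R) : Prop :=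
  exists chi : nat -> pformula A sv,
    {uniform, (fun k => peval (chi k)) @ \oo --> psi}.

Definition equiv_over (A : set elt) V (sv : V -> lsort L) (b c : mtuple sv) :
    Prop :=
  forall chi : pformula A sv, peval chi b = peval chi c.

Definition faithful_combination V (sv : V -> lsort L)
    (F : set (mtuple sv -> R)) (psi : mtuple sv -> R) : Prop :=
  exists (I : Type) (theta : connective R I) (f : I -> mtuple sv -> R),
    [/\ faithful theta, forall i, F (f i) &
        forall a, psi a = theta (fun i => f i a)].

Definition instance V W (sv : V -> lsort L) (sw : W -> lsort L)
    (phi : formula (ctx_sum sv sw)) (b : mtuple sw) : mtuple sv -> R :=
  fun a => feval phi (mtuple_sum a b).

Record automorphism (g : forall s, M s -> M s) : Prop := Automorphism {
  aut_bij : forall s, bijective (g s) ;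
  aut_dist : forall s (x y : M s), mdist (g s x) (g s y) = mdist x y ;
  aut_fint : forall (f : fsym L) (x : forall k, M (@fdom _ L f k)),
    fint (fun k => g _ (x k)) = g _ (fint x) ;
  aut_pint : forall (p : psym L) (x : forall k, M (@pdom _ L p k)),
    pint (fun k => g _ (x k)) = pint x }.

End Semantics.

Definition stable (R : realType) (L : language R) (T : set (sentence L))
    V W (sv : V -> lsort L) (sw : W -> lsort L)
    (phi : formula (ctx_sum sv sw)) : Prop :=
  forall N : structure L, models N T -> ~ order_property N phi.

(* The saturation cardinal is given as the cardinality of a type [K]. *)
Definition small (K U : Type) (A : set U) : Prop := ~~ ([set: K] #<= A).

Section Monster.
Context {R : realType} {L : language R} (K : Type) (M : structure L).

Definition saturated : Prop :=
  forall (A : set (elt M)) (n : nat) (sv : 'I_n -> lsort L)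
    (P : set (pformula A sv)), small K A ->
    (forall G eps, finite_set G -> G `<=` P -> 0 < eps ->
       exists a : mtuple M sv, forall chi, G chi -> peval chi a <= eps) ->
    realises P !=set0.

Definition strongly_homogeneous : Prop :=
  forall (I : Type) (si : I -> lsort L) (c d : mtuple M si),
    small K [set: I] ->
    (forall chi : formula si, feval chi c = feval chi d) ->
    exists2 g : forall s, M s -> M s,
      automorphism g & forall i, g _ (c i) = d i.

Record monster (T : set (sentence L)) : Prop := Monster {
  monster_models : models M T ;
  monster_uncountable : small K [set: nat] ;
  monster_sort : small K [set: lsort L] ;
  monster_fsym : small K [set: fsym L] ;
  monster_psym : small K [set: psym L] ;
  monster_saturated : saturated ;
  monster_homogeneous : strongly_homogeneous }.

End Monster.

(* Main.v *)
Require Import Defs.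
From HB Require Import structures.
From mathcomp Require Import all_boot all_order all_algebra.
From mathcomp Require Import all_classical all_reals all_analysis.
From mathcomp Require Import ring lra zify.
Import Order.TTheory GRing.Theory Num.Theory.
Import numFieldNormedType.Exports.
Local Open Scope classical_set_scope.
Local Open Scope ring_scope.
Local Open Scope card_scope.
Set Implicit Arguments.
Unset Strict Implicit.
Unset Printing Implicit Defensive.

(** Write f(a,b) for the value of phi at (a,b), and ~_B for conjugacy under the
    automorphisms of the monster fixing B pointwise.

    Stability bounds the length of the ladders of f (by saturation), hence the
    height of binary trees of tests f(a,.) >= r + d, f(a,.) <= r (Shelah's
    2-rank), hence, by a multiplicative weights argument, also the height of
    binary trees of tests between averages of f over finite families. So a
    family of conjugates of b over B that carries a tree of maximal height has
    an average a |-> Av_i f(a,b_i) which is almost constant on ~_B-classes: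
    otherwise the family and one of its translates would give a higher tree.
    By symmetry the same holds for averages of conjugates of a, and computing a
    double average in two ways (Harrington) shows that these almost invariant
    averages converge uniformly to a unique ~_B-invariant predicate psi_B.

    By compactness and homogeneity psi_B is definable over B, and for each
    epsilon it is within epsilon of psi_F for some finite F in B. It follows
    that psi_B' = psi_B for all small B' between some countable B in X and X.
    Taking B' to be B together with a point a of X gives psi_B(a) = f(a,b),
    since f(a,.) is constant on the ~_B'-class of b; and psi_B = psi_B' is a
    forced limit of averages of instances at conjugates of b over B'. *)

(** * Trees of tests *)

Section SplitRank.
Context {R : realType} {P Q : Type}.
Variables (f : P -> Q -> R) (d : R).

(** Shelah's 2-rank of [D] is at least [k]: a full binary tree of height [k] of tests from [S], with
    gap [d] between the two sides of a test, has all its branches realised in [D]. *)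
Fixpoint split_rank (S : set (P * R)) (k : nat) (D : set Q) : Prop :=
  if k is k'.+1 then
    exists t, [/\ S t, split_rank S k' (D `&` [set y | t.2 + d <= f t.1 y])
                & split_rank S k' (D `&` [set y | f t.1 y <= t.2])]
  else D !=set0.

Lemma split_rank_sub (S S' : set (P * R)) k (D D' : set Q) :
  S `<=` S' -> D `<=` D' -> split_rank S k D -> split_rank S' k D'.
Proof.
move=> SS'; elim: k D D' => [|k IH] D D' DD' /=.
  by move=> [y Dy]; exists y; exact: DD'.
move=> [t [St h l]]; exists t; split; first exact: SS'.
  by apply: IH h => y [/DD'].
by apply: IH l => y [/DD'].
Qed.

Lemma split_rank_n0 S k D : split_rank S k D -> D !=set0.
Proof.
elim: k D => [//|k IH] D /= [t [_ /IH[y [Dy _]] _]]; by exists y.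
Qed.

(** Ramsey's theorem for trees whose tests are coloured by [S] and [S']. If the root test is in [S],
    induction gives on each side rank [p - 1] for [S] or rank [q] for [S']; either one side settles
    the matter, or the root joins two [S]-trees. *)
Lemma split_rankU (S S' : set (P * R)) p q (D : set Q) :
  split_rank (S `|` S') (p + q) D -> split_rank S p D \/ split_rank S' q D.
Proof.
move: {2}(p + q)%N (erefl (p + q)%N) => N.
elim: N p q D => [|N IH] p q D eN rD.
  move: eN => /eqP; rewrite addn_eq0 => /andP[/eqP-> _].
  by left; exact: split_rank_n0 rD.
case: p eN rD => [|p] eN rD; first by left; exact: split_rank_n0 rD.
case: q eN rD => [|q] eN rD; first by right; exact: split_rank_n0 rD.
move: rD; rewrite addSn => -[t [St h l]].
have sub S0 k (A : set Q) : split_rank S0 k (D `&` A) -> split_rank S0 k D.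
  by apply: split_rank_sub => // y [].
case: St => St.
  have [h'|/sub ?] := IH p q.+1 _ ltac:(lia) h; last by right.
  have [l'|/sub ?] := IH p q.+1 _ ltac:(lia) l; last by right.
  by left; exists t.
have e : (p + q.+1 = p.+1 + q)%N by lia.
rewrite e in h l.
have [/sub ?|h'] := IH p.+1 q _ ltac:(lia) h; first by left.
have [/sub ?|l'] := IH p.+1 q _ ltac:(lia) l; first by left.
by right; exists t.
Qed.

(** One threshold at a time is peeled off by [split_rankU]; each may use up [p] levels of the
    tree. *)
Lemma split_rank_threshold (r : nat -> R) (K p : nat) (D : set Q) :
  split_rank [set t | exists2 k, (k <= K)%N & t.2 = r k] (K.+1 * p) D ->
  exists k, split_rank [set t | t.2 = r k] p D.
Proof.
elim: K => [|K IH].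
  rewrite mul1n => h; exists 0%N; apply: split_rank_sub h => //= t [k].
  by rewrite leqn0 => /eqP ->.
rewrite mulSn => h.
have : split_rank ([set t : P * R | t.2 = r K.+1] `|`
          [set t | exists2 k, (k <= K)%N & t.2 = r k]) (p + K.+1 * p) D.
  apply: split_rank_sub h => // t [k kK tk].
  by move: kK; rewrite leq_eqVlt => /orP[/eqP kK|kK]; [left; rewrite /= tk kK|right; exists k].
by move=> /split_rankU[h'|/IH//]; exists K.+1.
Qed.

Definition ladder (e : R) (N : nat) := exists (a : nat -> P) (y : nat -> Q),
  forall i j, (i < j < N)%N -> e <= `|f (a i) (y j) - f (a j) (y i)|.

(** The recursion matches a step of [split_rank_ladder_in]: the pigeonhole on two classes of tests
    halves the height, and one further level is spent on a test. *)
Fixpoint ladder_height n := if n is n'.+1 then (ladder_height n').+1.*2 else 0%N.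

(* The point [y] splits the tests into two classes; one of them keeps half of
   the rank, and one then moves to the side of a test [a] in this class on which
   the values of [f a] are on the other side of the gap. *)
Lemma split_rank_ladder_in (a0 : P) (r : R) N (S : set (P * R)) (D : set Q) :
  0 < d -> S `<=` [set t | t.2 = r] -> split_rank S (ladder_height N) D ->
  exists (a : nat -> P) (y : nat -> Q), (forall i, (i < N)%N ->
      S (a i, r) /\ D (y i)) /\
    forall i j, (i < j < N)%N -> d / 2 <= `|f (a i) (y j) - f (a j) (y i)|.
Proof.
move=> d0; elim: N S D => [|N IH] S D Sr.
  by move=> [y _]; exists (fun=> a0), (fun=> y); split => // i j; lia.
rewrite [ladder_height _.+1]/= => rD; have [y Dy] := split_rank_n0 rD.
have : split_rank ((S `&` [set t | t.2 + d / 2 <= f t.1 y]) `|`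
                   (S `&` [set t | f t.1 y < t.2 + d / 2]))
     ((ladder_height N).+1 + (ladder_height N).+1) D.
  rewrite addnn; apply: split_rank_sub rD => // t St.
  by case: (lerP (t.2 + d / 2) (f t.1 y)) => ?; [left|right].
move=> /split_rankU[] [[a r'] [[/[dup] Sa /Sr /= ->]]] /= ha hi lo.
- have [|b [z [bz hbz]]] := IH _ _ _ lo; first by move=> t [/Sr].
  exists (fun i => if i is i'.+1 then b i' else a),
         (fun i => if i is i'.+1 then z i' else y); split.
    case=> [_|i iN]; first by split => //; move: (Sr _ Sa) => /= <-.
    by have [[? _] [? _]] := bz i iN.
  case=> [|i] [|j] //= ij; last by apply: hbz; lia.
  have [[_ /= h1] [_ /= h2]] := bz j ltac:(lia).
  by rewrite distrC; apply: le_trans (ler_norm _); lra.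
- have [|b [z [bz hbz]]] := IH _ _ _ hi; first by move=> t [/Sr].
  exists (fun i => if i is i'.+1 then b i' else a),
         (fun i => if i is i'.+1 then z i' else y); split.
    case=> [_|i iN]; first by split => //; move: (Sr _ Sa) => /= <-.
    by have [[? _] [? _]] := bz i iN.
  case=> [|i] [|j] //= ij; last by apply: hbz; lia.
  have [[_ /= h1] [_ /= h2]] := bz j ltac:(lia).
  by apply: le_trans (ler_norm _); lra.
Qed.

Lemma split_rank_ladder (r : nat -> R) (K N : nat) :
  0 < d -> split_rank [set t | exists2 k, (k <= K)%N & t.2 = r k]
    (K.+1 * (ladder_height N).+1) setT -> ladder (d / 2) N.
Proof.
(* The additional level of the tree yields a test [t], whose point [t.1] serves as the default value
   of the ladder. *)
move=> d0 /split_rank_threshold[k [t [_ h _]]].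
have [a [y [_ ay]]] := split_rank_ladder_in t.1 d0 (@subset_refl _ _) h.
by exists a, y.
Qed.

(** * Multiplicative weights on trees of tests *)

Inductive test_tree := Leaf of Q | Node of P * R & test_tree & test_tree.

Fixpoint leafsum (F : Q -> R) t :=
  match t with
  | Leaf y => F y
  | Node _ t1 t2 => leafsum F t1 + leafsum F t2
  end.

Definition score (b : bool) : R := if b then 1 else -1.
Definition hi_score (p : P * R) y := score (p.2 + d <= f p.1 y).
Definition lo_score (p : P * R) y := score (f p.1 y <= p.2).

(* Multiplicative weights: [hi] is the correct prediction for the leaves of [t1],
   [lo] for those of [t2]. *)
Fixpoint weight (l : R) (F : Q -> R) t :=
  match t with
  | Leaf y => F y
  | Node p t1 t2 =>
      weight l (fun y => F y * expR (l * hi_score p y)) t1 +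
      weight l (fun y => F y * expR (l * lo_score p y)) t2
  end.

(** A full binary tree of height [n] of tests between averages: the leaves are arbitrary points,
    which may fail the tests above them, but at each node the test tells the leaves of the two
    subtrees apart with mean score at least [c]. *)
Fixpoint balanced (S : set (P * R)) (c : R) n t : Prop :=
  match t, n with
  | Leaf _, 0%N => True
  | Node p t1 t2, n'.+1 => [/\ S p, balanced S c n' t1, balanced S c n' t2 &
      c * 2 ^+ n <= leafsum (hi_score p) t1 + leafsum (lo_score p) t2]
  | _, _ => False
  end.

Lemma leafsumD F G t : leafsum (fun y => F y + G y) t = leafsum F t + leafsum G t.
Proof. by elim: t => //= p t1 -> t2 ->; ring. Qed.

Lemma eq_weight l F G t : F =1 G -> weight l F t = weight l G t.
Proof. by move=> /funext ->. Qed.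

Lemma weightD l F G t : weight l (fun y => F y + G y) t = weight l F t + weight l G t.
Proof.
elim: t F G => //= p t1 IH1 t2 IH2 F G; rewrite addrACA -IH1 -IH2.
by congr (_ + _); apply: eq_weight => y; rewrite mulrDl.
Qed.

Lemma le_weight l F G t : (forall y, F y <= G y) -> weight l F t <= weight l G t.
Proof.
elim: t F G => //= p t1 IH1 t2 IH2 F G FG; apply: lerD.
  by apply: IH1 => y; rewrite ler_wpM2r// expR_ge0.
by apply: IH2 => y; rewrite ler_wpM2r// expR_ge0.
Qed.

Lemma expR_midpoint (u v : R) : 2 * expR ((u + v) / 2) <= expR u + expR v.
Proof.
have hu : expR u = expR (u / 2) ^+ 2.
  by rewrite expr2 -expRD; congr expR; field.
have hv : expR v = expR (v / 2) ^+ 2.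
  by rewrite expr2 -expRD; congr expR; field.
rewrite hu hv [(u + v) / 2]mulrDl expRD.
have := sqr_ge0 (expR (u / 2) - expR (v / 2)); nra.
Qed.

(** Convexity of the exponential: the weight is at least what the mean exponent gives, and each of
    the [n] levels contributes at least [c] to the mean score of the leaves. For the induction, [k]
    is the score collected so far. *)
Lemma weight_ge S c l n t (k : Q -> R) : 0 <= l -> balanced S c n t ->
  2 ^+ n * expR (l * (leafsum k t / 2 ^+ n + c * n%:R)) <=
    weight l (fun y => expR (l * k y)) t.
Proof.
move=> l0; elim: t n k => [y|p t1 IH1 t2 IH2] [|n] k //=.
  by move=> _; rewrite expr0 mul1r divr1 mulr0 addr0.
move=> [_ b1 b2 hc].
have E F t : weight l (fun y => expR (l * k y) * expR (l * F y)) t =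
    weight l (fun y => expR (l * (k y + F y))) t.
  by apply: eq_weight => y; rewrite -expRD mulrDr.
rewrite !E; apply: le_trans (lerD (IH1 _ _ b1) (IH2 _ _ b2)).
rewrite !leafsumD -mulrDr exprS (mulrC 2) -mulrA ler_wpM2l ?exprn_ge0//.
apply: le_trans (expR_midpoint _ _).
rewrite ler_wpM2l// ler_expR -mulrDr -mulrA ler_wpM2l//.
rewrite exprS in hc.
have p0 : 0 < 2 ^+ n :> R by rewrite exprn_gt0.
set q := 2 ^+ n in hc p0 *.
rewrite -[n.+1]addn1 natrD.
rewrite [leRHS](_ : _ = (leafsum k t1 + leafsum k t2) / (2 * q) +
  (leafsum (hi_score p) t1 + leafsum (lo_score p) t2) / (2 * q) + c * n%:R); last first.
  by field; rewrite gt_eqF.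
rewrite [q * 2]mulrC mulrDr mulr1 [c * n%:R + c]addrC addrA lerD2r lerD2l.
by rewrite ler_pdivlMr ?mulr_gt0.
Qed.

Lemma expR_le_geom (l : R) : 0 <= l -> l <= 2^-1 -> expR l <= 1 + l + 2 * l ^+ 2.
Proof.
move=> l0 l1; have h : expR l * (1 - l) <= 1.
  rewrite -[leRHS](expRxMexpNx_1 l) ler_wpM2l ?expR_ge0//.
  by apply: le_trans (expR_ge1Dx _).
have l2 : 0 < 1 - l by lra.
rewrite -(ler_pM2r l2); apply: le_trans h _; nra.
Qed.

Lemma expRN_le (l : R) : 0 <= l -> expR (- l) <= 1 - l + l ^+ 2.
Proof.
move=> l0; have h : expR (- l) * (1 + l) <= 1.
  rewrite -[leRHS](expRxMexpNx_1 l) mulrC ler_wpM2r ?expR_ge0//.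
  exact: expR_ge1Dx.
have l2 : 0 < 1 + l by lra.
rewrite -(ler_pM2r l2); apply: le_trans h _; nra.
Qed.

(** A test cuts [D] into two parts, one of which loses rank. In the subtree that predicts this part,
    points outside it are multiplied by [expR (- l)], so that the factor [expR l + expR (- l)],
    close to 2, goes with the old rank and [expR l] with the smaller one. This recursion adds only a
    polynomial factor of degree [M] to [2 ^+ n * (1 + 2 * l ^+ 2) ^+ n]. *)
Lemma weight_le S c l n t M (D : set Q) (w : R) : 0 <= l -> l <= 2^-1 ->
  0 <= w -> ~ split_rank S M D -> balanced S c n t ->
  weight l (fun y => w * \1_D y) t <=
    w * (2 ^+ n * (1 + 2 * l ^+ 2) ^+ n * n.+1%:R ^+ M).
Proof.
move=> l0 l1.
have e1 := expR_le_geom l0 l1; have e2 := expRN_le l0.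
have e0 := expR_gt0 l; have e0' := expR_gt0 (- l).
set C := 1 + 2 * l ^+ 2.
have C1 : 1 <= C by rewrite lerDl mulr_ge0// sqr_ge0.
elim: t n M D w => [y|p t1 IH1 t2 IH2] [|n] M D w w0 rD //=.
  by move=> _; rewrite !expr0 !mul1r expr1n ler_wpM2l// indicE lern1 leq_b1.
move=> [Sp b1 b2 _].
case: M rD => [|M] rD.
  have D0 : D = set0 by apply/seteqP; split => // y Dy; case: rD; exists y.
  rewrite D0.
  have H F t : weight l (fun y => w * \1_set0 y * F y) t = 0.
    elim: t F => [y|q s1 I1 s2 I2] F /=; first by rewrite indicE in_set0 mulr0 mul0r.
    under eq_weight do rewrite -mulrA.
    rewrite I1; under eq_weight do rewrite -mulrA.
    by rewrite I2 addr0.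
  by rewrite !H addr0 mulr_ge0// !mulr_ge0// exprn_ge0//; lra.
pose U m := 2 ^+ n * C ^+ n * n.+1%:R ^+ m.
have step : (expR l + expR (- l)) * U M.+1 + expR l * U M <=
    2 ^+ n.+1 * C ^+ n.+1 * n.+2%:R ^+ M.+1.
  rewrite /U.
  have -> : 2 ^+ n.+1 * C ^+ n.+1 * n.+2%:R ^+ M.+1 =
      (2 ^+ n * C ^+ n) * (2 * C * n.+2%:R ^+ M.+1) by rewrite !exprS; ring.
  have -> : (expR l + expR (- l)) * (2 ^+ n * C ^+ n * n.+1%:R ^+ M.+1) +
    expR l * (2 ^+ n * C ^+ n * n.+1%:R ^+ M) =
    (2 ^+ n * C ^+ n) *
      ((expR l + expR (- l)) * n.+1%:R ^+ M.+1 + expR l * n.+1%:R ^+ M) by ring.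
  rewrite ler_wpM2l//; first by rewrite mulr_ge0// exprn_ge0//; lra.
  have n0 : 0 <= n.+1%:R ^+ M :> R by rewrite exprn_ge0.
  have h1 : expR l + expR (- l) <= 2 * C by rewrite /C; nra.
  have h2 : expR l <= 2 * C by lra.
  have h3 : n.+1%:R ^+ M.+1 + n.+1%:R ^+ M <= n.+2%:R ^+ M.+1 :> R.
    rewrite -natrX -[n.+2%:R ^+ _]natrX -[n.+1%:R ^+ M]natrX -natrD ler_nat.
    rewrite (expnS n.+1) addnC -mulSn expnS leq_mul2l.
    by apply/orP; right; case: (M) => // M'; rewrite leq_exp2r.
  have n1 : 0 <= n.+1%:R ^+ M.+1 :> R by rewrite exprn_ge0.
  apply: le_trans (lerD (ler_wpM2r n1 h1) (ler_wpM2r n0 h2)) _.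
  by rewrite -mulrDr ler_wpM2l//; lra.
have [h|h] : ~ split_rank S M (D `&` [set y | p.2 + d <= f p.1 y]) \/
    ~ split_rank S M (D `&` [set y | f p.1 y <= p.2]).
- apply/not_andP => -[h1 h2]; apply: rD; by exists p.
- have A : weight l (fun y => w * \1_D y * expR (l * lo_score p y)) t2 <=
      w * expR l * U M.+1.
    apply: le_trans (IH2 n M.+1 D (w * expR l) _ rD b2); last by rewrite mulr_ge0// ltW.
    apply: le_weight => y; rewrite -!mulrA ler_wpM2l// mulrC ler_wpM2r// ler_expR.
    by rewrite /lo_score /score; case: ifP => _; lra.
  have B : weight l (fun y => w * \1_D y * expR (l * hi_score p y)) t1 <=
      w * expR l * U M + w * expR (- l) * U M.+1.
    apply: le_trans (lerD (IH1 n M _ (w * expR l) _ h b1)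
      (IH1 n M.+1 D (w * expR (- l)) _ rD b1)); try by rewrite mulr_ge0// ltW.
    rewrite -weightD; apply: le_weight => y.
    rewrite !indicE in_setI /hi_score /score.
    have -> : (y \in [set y | p.2 + d <= f p.1 y]) = (p.2 + d <= f p.1 y).
      by apply/idP/idP; rewrite inE.
    case: ifP => _; rewrite ?mulr1 ?mulrN1 ?andbT ?andbF ?mulr0 ?add0r -!mulrA ?[_%:R * _]mulrC//.
    by rewrite lerDl !mulr_ge0// ltW.
  apply: le_trans (lerD B A) _.
  apply: le_trans (ler_wpM2l w0 step); rewrite -!mulrA -!mulrDr ler_wpM2l//; lra.
- have A : weight l (fun y => w * \1_D y * expR (l * hi_score p y)) t1 <=
      w * expR l * U M.+1.
    apply: le_trans (IH1 n M.+1 D (w * expR l) _ rD b1); last by rewrite mulr_ge0// ltW.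
    apply: le_weight => y; rewrite -!mulrA ler_wpM2l// mulrC ler_wpM2r// ler_expR.
    by rewrite /hi_score /score; case: ifP => _; lra.
  have B : weight l (fun y => w * \1_D y * expR (l * lo_score p y)) t2 <=
      w * expR l * U M + w * expR (- l) * U M.+1.
    apply: le_trans (lerD (IH2 n M _ (w * expR l) _ h b2)
      (IH2 n M.+1 D (w * expR (- l)) _ rD b2)); try by rewrite mulr_ge0// ltW.
    rewrite -weightD; apply: le_weight => y.
    rewrite !indicE in_setI /lo_score /score.
    have -> : (y \in [set y | f p.1 y <= p.2]) = (f p.1 y <= p.2).
      by apply/idP/idP; rewrite inE.
    case: ifP => _; rewrite ?mulr1 ?mulrN1 ?andbT ?andbF ?mulr0 ?add0r -!mulrA ?[_%:R * _]mulrC//.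
    by rewrite lerDl !mulr_ge0// ltW.
  apply: le_trans (lerD A B) _.
  apply: le_trans (ler_wpM2l w0 step); rewrite -!mulrA -!mulrDr ler_wpM2l//; lra.
Qed.

Lemma expR_gt_poly (e : R) M : 0 < e -> exists n : nat, n.+1%:R ^+ M < expR (e * n%:R).
Proof.
move=> e0; pose k := e / M.+1%:R.
have k0 : 0 < k by rewrite divr_gt0.
have [n hn] : exists n : nat, expR e / k ^+ M.+1 < n.+1%:R.
  have hn := archi_boundP (ltW (divr_gt0 (expR_gt0 e) (exprn_gt0 M.+1 k0))).
  by exists (Num.bound (expR e / k ^+ M.+1)); apply: lt_trans hn _; rewrite ltr_nat.
exists n; rewrite -(ltr_pM2r (expR_gt0 e)) -expRD.
have -> : e * n%:R + e = M.+1%:R * (k * n.+1%:R).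
  by rewrite /k [RHS]mulrC [RHS]mulrAC divfK ?pnatr_eq0// -[n.+1]addn1 natrD mulrDr mulr1.
rewrite expRM_natl.
have h : k * n.+1%:R <= expR (k * n.+1%:R).
  by apply: le_trans (expR_ge1Dx _); lra.
have h0 : 0 <= k * n.+1%:R by rewrite mulr_ge0// ltW.
apply: lt_le_trans (_ : (k * n.+1%:R) ^+ M.+1 <= _); last first.
  by rewrite lerXn2r ?nnegrE// expR_ge0.
rewrite exprMn [n.+1%:R ^+ M.+1]exprS mulrCA mulrA [ltRHS]mulrC ltr_pM2l ?exprn_gt0//.
by move: hn; rewrite ltr_pdivrMr ?exprn_gt0.
Qed.

(** The two bounds of the weight, divided by [2 ^+ n], put an exponential in [n] below a
    polynomial. *)
Lemma balanced_bounded S c M : 0 < c -> c <= 2 -> ~ split_rank S M setT ->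
  exists n, forall t, ~ balanced S c n t.
Proof.
move=> c0 c2 rS; have [n hn] := @expR_gt_poly (c ^+ 2 / 8) M ltac:(nra).
exists n => t bt.
(* This value maximises [l * c - 2 * l ^+ 2], the exponential rate by which the lower bound of the
   weight exceeds the upper one; the maximum is [c ^+ 2 / 8]. *)
pose l := c / 4.
have l0 : 0 <= l by rewrite /l; lra.
have l1 : l <= 2^-1 by rewrite /l; lra.
have A := weight_ge (fun=> 0) l0 bt.
have B := weight_le l0 l1 ler01 rS bt.
have E : weight l (fun y => expR (l * 0)) t = weight l (fun y => 1 * \1_[set: Q] y) t.
  by apply: eq_weight => y; rewrite mulr0 expR0 mul1r indicE in_setT.
have Z : leafsum (fun=> 0) t = 0 by elim: (t) => //= _ s1 -> s2 ->; rewrite addr0.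
rewrite E Z mul0r add0r in A; have := le_trans A B.
rewrite mul1r -mulrA ler_pM2l ?exprn_gt0// => H.
have C : (1 + 2 * l ^+ 2) ^+ n <= expR (2 * l ^+ 2 * n%:R).
  rewrite [2 * _ * n%:R]mulrC expRM_natl lerXn2r ?nnegrE ?expR_ge0 ?expR_ge1Dx//.
  by have := sqr_ge0 l; lra.
have n0 : 0 <= n.+1%:R ^+ M :> R by rewrite exprn_ge0.
have := le_trans H (ler_wpM2r n0 C).
rewrite -(ler_pM2l (expR_gt0 (- (2 * l ^+ 2 * n%:R)))) -expRD mulrA -expRD addNr expR0 mul1r.
rewrite (_ : _ + _ = c ^+ 2 / 8 * n%:R); last by rewrite /l; field.
by rewrite leNgt hn.
Qed.

End SplitRank.

(** * Thresholds and almost invariant averages *)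

Section Thresholds.
Context {R : realType}.

(** As many thresholds are passed as the integer part of [u] says, so the mean score over all
    thresholds recovers [u] up to rounding. This turns gaps between averages of values into scores
    of tests. *)
Lemma sum_score_hi (u : R) (N : nat) : 0 <= u -> u <= N%:R ->
  2 * u - 2 - N%:R <= \sum_(k < N) score (k%:R + 1 <= u).
Proof.
move=> u0; suff: (N%:R <= u -> \sum_(k < N) score (k%:R + 1 <= u) = N%:R :> R) /\
    (u <= N%:R -> 2 * u - 2 - N%:R <= \sum_(k < N) score (k%:R + 1 <= u)).
  by move=> [_ h] /h.
elim: N => [|N [IH1 IH2]]; first by rewrite big_ord0; split => //; lra.
rewrite big_ord_recr /= -addn1 natrD.
case: (lerP (N%:R + 1) u) => h; rewrite /score/=.
  by split; move=> ?; rewrite IH1; lra.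
split; first by lra.
move=> _; have [h'|h'] := lerP N%:R u; first by rewrite IH1//; lra.
by have := IH2 (ltW h'); lra.
Qed.

Lemma sum_score_lo (u : R) (N : nat) : 0 <= u ->
  N%:R - 2 * u - 2 <= \sum_(k < N) score (u <= k%:R).
Proof.
move=> u0; suff: - N%:R <= \sum_(k < N) score (u <= k%:R) :> R /\
    N%:R - 2 * u - 2 <= \sum_(k < N) score (u <= k%:R).
  by case.
elim: N => [|N [IH1 IH2]]; first by rewrite big_ord0; lra.
rewrite big_ord_recr /= -addn1 natrD.
by case: (lerP u N%:R) => h; rewrite /score/=; lra.
Qed.

End Thresholds.

Section ApproximateInvariance.
Context {R : realType} {P Q : Type}.
Variable (f : P -> Q -> R).
Hypothesis f01 : forall a y, 0 <= f a y <= 1.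

Local Notation leafsum := (@leafsum R P Q).

Lemma le_leafsum F G t : (forall y, F y <= G y) -> leafsum F t <= leafsum G t.
Proof. by move=> FG; elim: t => //= p t1 IH1 t2 IH2; exact: lerD. Qed.

Lemma leafsum_sum N (F : 'I_N -> Q -> R) t :
  leafsum (fun y => \sum_k F k y) t = \sum_k leafsum (F k) t.
Proof. by elim: t => //= p t1 -> t2 ->; rewrite -big_split. Qed.

Lemma leafsumM c F t : leafsum (fun y => c * F y) t = c * leafsum F t.
Proof. by elim: t => //= p t1 -> t2 ->; rewrite mulrDr. Qed.

Lemma leafsum_cst d S c n t (x : R) : balanced f d S c n t ->
  leafsum (fun=> x) t = x * 2 ^+ n.
Proof.
elim: t n => [y|p t1 IH1 t2 IH2] [|n]//=; first by rewrite mulr1.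
by move=> [_ /IH1 -> /IH2 -> _]; rewrite exprS; ring.
Qed.

Definition grid (K : nat) : set (P * R) :=
  [set t | exists2 k, (k <= K)%N & t.2 = k%:R / K.+1%:R].

(** Summed over the [K.+1] thresholds of the grid, the scores add up to at least [2 * K.+1] times
    the difference of the two sums, less [4 * 2 ^+ n] for rounding. Some threshold reaches the mean;
    the rounding costs at most half of it, which explains [e / 2]. *)
Lemma balanced_node (K : nat) (e : R) n t1 t2 (a : P) :
  4 / K.+1%:R <= e ->
  balanced f K.+1%:R^-1 (grid K) (e / 2) n t1 ->
  balanced f K.+1%:R^-1 (grid K) (e / 2) n t2 ->
  e * 2 ^+ n <= leafsum (f a) t1 - leafsum (f a) t2 ->
  exists r, balanced f K.+1%:R^-1 (grid K) (e / 2) n.+1 (Node (a, r) t1 t2).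
Proof.
move=> Ke b1 b2 gap.
pose d : R := K.+1%:R^-1.
have K0 : 0 < K.+1%:R :> R by rewrite ltr0n.
have p0 : 0 < 2 ^+ n :> R by rewrite exprn_gt0.
have [k hk] : exists k : 'I_K.+1, e / 2 * 2 ^+ n.+1 <=
    leafsum (hi_score f d (a, k%:R / K.+1%:R)) t1 +
    leafsum (lo_score f (a, k%:R / K.+1%:R)) t2.
  apply: contrapT => /forallNP H.
  have : \sum_(k < K.+1) (leafsum (hi_score f d (a, k%:R / K.+1%:R)) t1 +
    leafsum (lo_score f (a, k%:R / K.+1%:R)) t2) < \sum_(k < K.+1) (e / 2 * 2 ^+ n.+1).
    apply: ltr_sum => [|k _]; last by rewrite ltNge; apply/negP; exact: H.
    by apply/hasP; exists ord0; rewrite ?mem_index_enum.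
  apply/negP; rewrite -leNgt sumr_const card_ord -[leLHS]mulr_natr.
  rewrite big_split /= -!leafsum_sum.
  have A : leafsum (fun y => 2 * K.+1%:R * f a y + (- 2 - K.+1%:R)) t1 <=
      leafsum (fun y => \sum_(k < K.+1) hi_score f d (a, k%:R / K.+1%:R) y) t1.
    apply: le_leafsum => y; have /andP[f0 f1] := f01 a y.
    have -> : \sum_(k < K.+1) hi_score f d (a, k%:R / K.+1%:R) y =
        \sum_(k < K.+1) score (k%:R + 1 <= K.+1%:R * f a y).
      apply: eq_bigr => k _; rewrite /hi_score/= /d; congr score.
      by rewrite -[X in _ + X]mul1r -mulrDl ler_pdivrMr// mulrC.
    apply: le_trans (sum_score_hi _ _); first by lra.
      by rewrite mulr_ge0// ltW.
    by rewrite ger_pMr.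
  have B : leafsum (fun y => - (2 * K.+1%:R) * f a y + (K.+1%:R - 2)) t2 <=
      leafsum (fun y => \sum_(k < K.+1) lo_score f (a, k%:R / K.+1%:R) y) t2.
    apply: le_leafsum => y; have /andP[f0 f1] := f01 a y.
    have -> : \sum_(k < K.+1) lo_score f (a, k%:R / K.+1%:R) y =
        \sum_(k < K.+1) score (K.+1%:R * f a y <= k%:R).
      apply: eq_bigr => k _; rewrite /lo_score/=; congr score.
      by rewrite ler_pdivlMr// mulrC.
    apply: le_trans (sum_score_lo _ _); first by lra.
    by rewrite mulr_ge0// ltW.
  apply: le_trans (lerD A B).
  rewrite !leafsumD !leafsumM !(leafsum_cst _ b1) !(leafsum_cst _ b2).
  have Ke' : 4 <= e * K.+1%:R by rewrite -ler_pdivrMr.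
  have G : 0 <= K.+1%:R * (leafsum (f a) t1 - leafsum (f a) t2 - e * 2 ^+ n).
    by rewrite mulr_ge0// ?(ltW K0)// subr_ge0.
  have E : 0 <= (e * K.+1%:R - 4) * 2 ^+ n by rewrite mulr_ge0// ?(ltW p0)// subr_ge0.
  rewrite exprS; move: G E; move: (leafsum _ t1) (leafsum _ t2) => x y.
  move: (2 ^+ n : R) (K.+1%:R : R) => q k; clear; nra.
exists (k%:R / K.+1%:R); split => //; exists k => //.
by rewrite -ltnS.
Qed.

Fixpoint leaves (t : @test_tree R P Q) : seq Q :=
  match t with Leaf y => [:: y] | Node _ t1 t2 => leaves t1 ++ leaves t2 end.

Lemma leafsumE F t : leafsum F t = \sum_(y <- leaves t) F y.
Proof. by elim: t => [y|p t1 IH1 t2 IH2] /=; rewrite ?big_seq1// big_cat IH1 IH2. Qed.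

Lemma size_leaves d S c n t : balanced f d S c n t -> size (leaves t) = (2 ^ n)%N.
Proof.
elim: t n => [y|p t1 IH1 t2 IH2] [|n]//= [_ /IH1 h1 /IH2 h2 _].
by rewrite size_cat h1 h2 expnS mul2n addnn.
Qed.

Definition avg (F : Q -> R) (s : seq Q) : R := (\sum_(y <- s) F y) / (size s)%:R.

Context {G : Type}.
Variables (gP : G -> P -> P) (gQ : G -> Q -> Q).
Hypothesis f_inv : forall g a y, f (gP g a) (gQ g y) = f a y.

Fixpoint act_tree g (t : @test_tree R P Q) : @test_tree R P Q :=
  match t with
  | Leaf y => Leaf (gQ g y)
  | Node p t1 t2 => Node (gP g p.1, p.2) (act_tree g t1) (act_tree g t2)
  end.

Lemma leafsum_act F g t : leafsum F (act_tree g t) = leafsum (F \o gQ g) t.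
Proof. by elim: t => //= p t1 -> t2 ->. Qed.

Lemma balanced_act d c K n g t :
  balanced f d (grid K) c n t -> balanced f d (grid K) c n (act_tree g t).
Proof.
elim: t n => [y|p t1 IH1 t2 IH2] [|n]//= [Sp /IH1 h1 /IH2 h2 h]; split => //.
rewrite !leafsum_act; apply: le_trans h _.
suff -> : hi_score f d (gP g p.1, p.2) \o gQ g = hi_score f d p.
  suff -> : lo_score f (gP g p.1, p.2) \o gQ g = lo_score f p by [].
  by apply/funext => y; rewrite /lo_score/= f_inv.
by apply/funext => y; rewrite /hi_score/= f_inv.
Qed.

(* If averaging over the leaves of a tree [t] is not nearly invariant, then [t]
   and some translate [g t] can be joined to a higher tree. *)
Lemma approx_invariant_avg (O : set Q) (y0 : Q) (e : R) :
  (forall d, 0 < d -> exists N, ~ ladder f d N) ->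
  O y0 -> (forall g y, O y -> O (gQ g y)) -> 0 < e ->
  exists s : seq Q, [/\ (0 < size s)%N, forall y, List.In y s -> O y &
    forall g a, `|avg (f a) s - avg (f (gP g a)) s| <= e].
Proof.
move=> nolad Oy0 Og; wlog e2 : e / e <= 2.
  move=> W e0; have [h|h] := lerP e 2; first exact: W.
  have [s [s0 sO hs]] := W 2 (lexx _) (ltr0Sn _ _).
  by exists s; split => // g a; apply: le_trans (hs g a) _; exact: ltW.
move=> e0.
have [K hK] : exists K : nat, 4 / K.+1%:R <= e.
  have h := archi_boundP (ltW (divr_gt0 (ltr0Sn R 3) e0)).
  exists (Num.bound (4 / e)); rewrite ler_pdivrMr// mulrC -ler_pdivrMr//.
  by apply: le_trans (ltW h) _; rewrite ler_nat.
pose d : R := K.+1%:R^-1.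
have d0 : 0 < d by rewrite invr_gt0.
have [N hN] := nolad (d / 2) (divr_gt0 d0 (ltr0Sn R 1)).
have nrk : ~ split_rank f d (grid K) (K.+1 * (ladder_height N).+1) setT.
  by move=> /(split_rank_ladder d0).
have [n hn] := @balanced_bounded R P Q f d (grid K) (e / 2) _ ltac:(lra) ltac:(lra) nrk.
apply: contrapT => H.
suff [t [_ /hn//]] : exists t, (forall y, List.In y (leaves t) -> O y) /\
  balanced f d (grid K) (e / 2) n t.
elim: n {hn} => [|n [t [tO bt]]]; first by exists (Leaf y0); split => // y [<-|].
have sz := size_leaves bt.
have [g [a hga]] : exists g a, e < `|avg (f a) (leaves t) - avg (f (gP g a)) (leaves t)|.
  apply: contrapT => H'; apply: H; exists (leaves t); split => //.
    by rewrite sz expn_gt0.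
  by move=> g a; rewrite leNgt; apply/negP => h; apply: H'; exists g, a.
have gO y : List.In y (leaves (act_tree g t)) -> O y.
  suff : forall t, (forall y, List.In y (leaves t) -> O y) ->
    forall y, List.In y (leaves (act_tree g t)) -> O y by move/(_ t tO); apply.
  elim=> [z|p t1 IH1 t2 IH2] /= tO' y'; first by move=> [<-|//]; apply/Og/tO'; left.
  move=> /(@List.in_app_or Q)[]; [apply: IH1|apply: IH2] => z hz; apply: tO'.
    by apply: List.in_or_app; left.
  by apply: List.in_or_app; right.
have bg := balanced_act g bt.
have p0 : 0 < 2 ^+ n :> R by rewrite exprn_gt0.
have E : leafsum (f (gP g a)) (act_tree g t) = leafsum (f a) t.
  by rewrite leafsum_act; congr (leafsum _ _); apply/funext => y /=; rewrite f_inv.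
move: hga; rewrite /avg sz -!leafsumE -mulrBl normrM [`|_^-1|]ger0_norm ?invr_ge0//.
rewrite natrX ltr_pdivlMr//.
have cat t1 t2 p : (forall y, List.In y (leaves t1) -> O y) ->
    (forall y, List.In y (leaves t2) -> O y) ->
    forall y, List.In y (leaves (Node p t1 t2)) -> O y.
  by move=> h1 h2 y /(@List.in_app_or Q)[/h1|/h2].
case: (lerP 0 (leafsum (f a) t - leafsum (f (gP g a)) t)) => hs hga.
  have [r br] := balanced_node (a := gP g a) hK bg bt
    ltac:(by rewrite E ltW// (lt_le_trans hga)// ger0_norm).
  by exists (Node (gP g a, r) (act_tree g t) t); split => //; exact: cat.
have [r br] := balanced_node (a := gP g a) hK bt bg
  ltac:(by rewrite E ltW// (lt_le_trans hga)// ltr0_norm// opprB).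
by exists (Node (gP g a, r) t (act_tree g t)); split => //; exact: cat.
Qed.

End ApproximateInvariance.

(** * Syntax and automorphisms *)

Section Substitution.
Context {R : realType} {L : language R}.

Fixpoint tsubst V W (sv : V -> lsort L) (sw : W -> lsort L)
    (g : forall v, term sw (sv v)) s (t : term sv s) : term sw s :=
  match t with
  | Var v => g v
  | App f ts => App (fun k => tsubst g (ts k))
  end.

Definition lift_subst V W (sv : V -> lsort L) (sw : W -> lsort L) s
    (g : forall v, term sw (sv v)) :
    forall o, term (ctx_ext s sw) (ctx_ext s sv o) :=
  fun o => match o with
  | Some v => tsubst (fun w => Var (ctx_ext s sw) (Some w)) (g v)
  | None => Var (ctx_ext s sw) None
  end.

Fixpoint fsubst V (sv : V -> lsort L) (phi : formula sv) :
    forall W (sw : W -> lsort L), (forall v, term sw (sv v)) -> formula sw :=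
  match phi with
  | Dist s t u => fun W sw g => Dist (tsubst g t) (tsubst g u)
  | Pred p ts => fun W sw g => Pred (fun k => tsubst g (ts k))
  | Conn n c ps => fun W sw g => Conn c (fun k => fsubst (ps k) g)
  | Sup s psi => fun W sw g => Sup (fsubst psi (lift_subst s g))
  | Inf s psi => fun W sw g => Inf (fsubst psi (lift_subst s g))
  end.

Variable M : structure L.

Lemma teval_subst V W (sv : V -> lsort L) (sw : W -> lsort L)
    (g : forall v, term sw (sv v)) s (t : term sv s) (e : mtuple M sw) :
  teval (tsubst g t) e = teval t (fun v => teval (g v) e).
Proof.
elim: t => //= f ts IH; congr fint.
by apply: functional_extensionality_dep => k; exact: IH.
Qed.

Lemma teval_lift V W (sv : V -> lsort L) (sw : W -> lsort L) s
    (g : forall v, term sw (sv v)) (e : mtuple M sw) (a : M s) :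
  (fun o => teval (lift_subst s g o) (mtuple_ext a e)) =
  mtuple_ext a (fun v => teval (g v) e) :> mtuple M _.
Proof.
by apply: functional_extensionality_dep => -[v|] //=; rewrite teval_subst.
Qed.

Lemma feval_subst V (sv : V -> lsort L) (phi : formula sv) W (sw : W -> lsort L)
    (g : forall v, term sw (sv v)) (e : mtuple M sw) :
  feval (fsubst phi g) e = feval phi (fun v => teval (g v) e).
Proof.
elim: phi W sw g e => {V sv} [V sv s t u|V sv p ts|V sv n c ps IH|V sv s psi IH|V sv s psi IH]
  W sw g e /=.
- by rewrite !teval_subst.
- by congr pint; apply: functional_extensionality_dep => k; exact: teval_subst.
- by apply: (congr1 (conn_fun c)); apply: functional_extensionality_dep => k; exact: IH.
- by apply: (congr1 (fun F => sup (range F))); apply/funext => a; rewrite IH teval_lift.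
- by apply: (congr1 (fun F => inf (range F))); apply/funext => a; rewrite IH teval_lift.
Qed.

Definition act_tuple (g : forall s, M s -> M s) V (sv : V -> lsort L)
  (e : mtuple M sv) : mtuple M sv := fun v => g _ (e v).

Lemma teval_aut g V (sv : V -> lsort L) s (t : term sv s) (e : mtuple M sv) :
  automorphism g -> teval t (act_tuple g e) = g _ (teval t e).
Proof.
move=> hg; elim: t => //= f ts IH; rewrite -(aut_fint hg); congr fint.
by apply: functional_extensionality_dep => k; exact: IH.
Qed.

Lemma feval_aut g V (sv : V -> lsort L) (phi : formula sv) (e : mtuple M sv) :
  automorphism g -> feval phi (act_tuple g e) = feval phi e.
Proof.
move=> hg.
have ext s U (su : U -> lsort L) (d : mtuple M su) (psi : formula (ctx_ext s su)) :
  (forall d', feval psi (act_tuple g d') = feval psi d') ->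
  range (fun a : M s => feval psi (mtuple_ext a (act_tuple g d))) =
  range (fun a : M s => feval psi (mtuple_ext a d)).
  move=> IH; have E a : mtuple_ext (g s a) (act_tuple g d) =
      act_tuple g (mtuple_ext a d) by apply: functional_extensionality_dep => -[].
  have [k gk kg] := aut_bij hg s; apply/seteqP; split => _ [a _ <-].
    by exists (k a) => //; rewrite -IH -E kg.
  by exists (g s a) => //; rewrite E IH.
elim: phi e => {V sv} [V sv s t u|V sv p ts|V sv n c ps IH|V sv s psi IH|V sv s psi IH] e /=.
- by rewrite !teval_aut// (aut_dist hg).
- rewrite -[RHS](aut_pint hg); congr pint.
  by apply: functional_extensionality_dep => k; exact: teval_aut.
- by apply: (congr1 (conn_fun c)); apply: functional_extensionality_dep => k; exact: IH.
- by congr sup; exact: ext.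
- by congr inf; exact: ext.
Qed.

Lemma feval_range V (sv : V -> lsort L) (phi : formula sv) (e : mtuple M sv) :
  0 <= feval phi e <= 1.
Proof.
elim: phi e => {V sv} [V sv s t u|V sv p ts|V sv n c ps IH|V sv s psi IH|V sv s psi IH] e /=.
- by rewrite mdist_ge0 carrier_diam.
- exact: pint_range.
- by apply: conn_range => k; exact: IH.
- have [a0] := carrier_inh M s; set S := (X in sup X).
  have S0 : S (feval psi (mtuple_ext a0 e)) by exists a0.
  have ubS : has_ubound S by exists 1 => _ [a _ <-]; have /andP[] := IH (mtuple_ext a e).
  apply/andP; split.
    by apply: le_trans (ub_le_sup ubS S0); have /andP[] := IH (mtuple_ext a0 e).
  apply: ge_sup; first by exists (feval psi (mtuple_ext a0 e)).
  by move=> _ [a _ <-]; have /andP[] := IH (mtuple_ext a e).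
- have [a0] := carrier_inh M s; set S := (X in inf X).
  have S0 : S (feval psi (mtuple_ext a0 e)) by exists a0.
  have lbS : has_lbound S by exists 0 => _ [a _ <-]; have /andP[] := IH (mtuple_ext a e).
  apply/andP; split; last first.
    by apply: le_trans (ge_inf lbS S0) _; have /andP[] := IH (mtuple_ext a0 e).
  apply: lb_le_inf; first by exists (feval psi (mtuple_ext a0 e)).
  by move=> _ [a _ <-]; have /andP[] := IH (mtuple_ext a e).
Qed.

Lemma teval_support V (sv : V -> lsort L) s (t : term sv s) :
  exists2 A : set V, finite_set A & forall e e' : mtuple M sv,
    (forall v, A v -> e v = e' v) -> teval t e = teval t e'.
Proof.
elim: t => [v|f ts IH]; first by exists [set v] => // e e'; apply.
have [A hA] := choice (fun k => (exists2P _ _).1 (IH k)).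
exists (\bigcup_k A k); first by apply: bigcup_finite => // k _; case: (hA k).
move=> e e' ee' /=; congr fint; apply: functional_extensionality_dep => k.
by apply: (hA k).2 => v Akv; apply: ee'; exists k.
Qed.

Lemma feval_support V (sv : V -> lsort L) (phi : formula sv) :
  exists2 A : set V, finite_set A & forall e e' : mtuple M sv,
    (forall v, A v -> e v = e' v) -> feval phi e = feval phi e'.
Proof.
have fin V' (A : set (option V')) : finite_set A -> finite_set (Some @^-1` A).
  by apply: finite_preimage => ? ? _ _ [].
have ext V' (sv' : V' -> lsort L) s (A : set (option V')) (e e' : mtuple M sv') (a : M s) :
    (forall v, (Some @^-1` A) v -> e v = e' v) ->
    forall o, A o -> mtuple_ext a e o = mtuple_ext a e' o.
  by move=> ee' [v|]//=; exact: ee'.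
elim: phi => {V sv} [V sv s t u|V sv p ts|V sv n c ps IH|V sv s psi [A fA IH]|V sv s psi [A fA IH]].
- have [A fA hA] := teval_support t; have [B fB hB] := teval_support u.
  exists (A `|` B); first by rewrite finite_setU.
  move=> e e' ee' /=; rewrite (hA e e') ?(hB e e')// => v h; apply: ee'; [right|left]; exact: h.
- have [A hA] := choice (fun k => (exists2P _ _).1 (teval_support (ts k))).
  exists (\bigcup_k A k); first by apply: bigcup_finite => // k _; case: (hA k).
  move=> e e' ee' /=; congr pint; apply: functional_extensionality_dep => k.
  by apply: (hA k).2 => v Akv; apply: ee'; exists k.
- have [A hA] := choice (fun k => (exists2P _ _).1 (IH k)).
  exists (\bigcup_k A k); first by apply: bigcup_finite => // k _; case: (hA k).
  move=> e e' ee' /=; apply: (congr1 (conn_fun c)); apply: functional_extensionality_dep => k.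
  by apply: (hA k).2 => v Akv; apply: ee'; exists k.
- exists (Some @^-1` A); first exact: fin.
  by move=> e e' ee' /=; apply: (congr1 (fun F => sup (range F))); apply/funext => a; exact/IH/ext.
- exists (Some @^-1` A); first exact: fin.
  by move=> e e' ee' /=; apply: (congr1 (fun F => inf (range F))); apply/funext => a; exact/IH/ext.
Qed.

End Substitution.

(** * Saturation *)

Section Ultralimits.
Context {R : realType}.

Definition ulim I (U : set_system I) (u : I -> R) (l : R) :=
  forall e, 0 < e -> U [set i | `|u i - l| <= e].

(** Compactness of the unit interval: the limit is the supremum of all [r] that lie below [u] on a
    set of the ultrafilter. *)
Lemma ulim_exists I (U : set_system I) (u : I -> R) : UltraFilter U ->
  (forall i, 0 <= u i <= 1) -> exists l, ulim U u l.
Proof.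
move=> UU u01; have FU : ProperFilter U by exact: ultra_proper.
pose E := [set r | U [set i | r <= u i]].
have E0 : E 0.
  by apply: filterS filterT => i _ /=; have /andP[] := u01 i.
have ubE : has_ubound E.
  exists 1 => r Er; have [i /= ri] := filter_ex Er.
  by apply: le_trans ri _; have /andP[] := u01 i.
have hE : has_sup E by split => //; exists 0.
exists (sup E) => e e0.
have [r Er re] := sup_adherent e0 hE.
have nE : ~ U [set i | sup E + e <= u i].
  by move=> h; have := ub_le_sup ubE h; rewrite leNgt ltrDl e0.
have [//|h] := in_ultra_setVsetC [set i | sup E + e <= u i] UU.
apply: filterS (filterI Er h) => i /= [h1 /negP]; rewrite -ltNge => h2.
by rewrite ler_norml; lra.
Qed.

Lemma ulim_le I (U : set_system I) (u : I -> R) l c : ProperFilter U ->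
  ulim U u l -> U [set i | u i <= c] -> l <= c.
Proof.
move=> FU h hc; apply/ler_addgt0Pr => e e0.
have [i /= [h1 h2]] := filter_ex (filterI (h _ e0) hc).
by move: h1; rewrite ler_norml; lra.
Qed.

Lemma ulim_dist_ge I (U : set_system I) (u v : I -> R) l l' c : ProperFilter U ->
  ulim U u l -> ulim U v l' -> U [set i | c <= `|u i - v i|] -> c <= `|l - l'|.
Proof.
move=> FU h h' hc; apply/ler_addgt0Pr => e e0.
have e20 : 0 < e / 2 by rewrite divr_gt0.
have [i /= [[h1 h2] h3]] := filter_ex (filterI (filterI (h _ e20) (h' _ e20)) hc).
apply: le_trans h3 _.
rewrite (_ : u i - v i = (l - l') + ((u i - l) - (v i - l'))); last by ring.
apply: le_trans (ler_normD _ _) _; rewrite lerD2l.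
by apply: le_trans (ler_normB _ _) _; lra.
Qed.

End Ultralimits.

Section LipschitzConnectives.
Context {R : realType}.

Lemma lipschitz_continuous n (F : ('I_n -> R) -> R) (C : R) :
  (forall x y, `|F x - F y| <= C * \sum_j `|x j - y j|) ->
  continuous (F : {ptws 'I_n -> R} -> R).
Proof.
move=> FC x.
apply/(@cvgrPdist_le R R^o {ptws 'I_n -> R} (nbhs (x : {ptws 'I_n -> R})) _ F (F x)) => e e0.
pose C' := Num.max C 1; pose h := e / (C' * n.+1%:R).
have C'0 : 0 < C' by rewrite lt_max ltr01 orbT.
have h0 : 0 < h by rewrite divr_gt0// mulr_gt0.
have hn : \forall y \near nbhs (x : {ptws 'I_n -> R}), forall j : 'I_n, `|x j - y j| <= h.
  apply: filter_forall => j.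
  have /(@cvgrPdist_le R R^o {ptws 'I_n -> R} (nbhs (x : {ptws 'I_n -> R})) _
    (fun y => y j) (x j)) := @proj_continuous _ (fun=> R) j (x : {ptws 'I_n -> R}).
  by move/(_ h h0).
apply: (@filterS _ (nbhs (x : {ptws 'I_n -> R})) _ _ _ _ hn) => y hy.
apply: le_trans (FC _ _) _.
apply: le_trans (_ : C' * \sum_j `|x j - y j| <= _).
  by rewrite ler_wpM2r ?sumr_ge0// le_max lexx.
apply: le_trans (_ : C' * \sum_(j < n) h <= _).
  by rewrite ler_wpM2l ?(ltW C'0)//; apply: ler_sum => j _.
rewrite sumr_const card_ord -[h *+ n]mulr_natr /h mulrCA mulrC -mulrA.
rewrite [leLHS](_ : _ = e * (n%:R / n.+1%:R)); last first.
  by field; rewrite (gt_eqF C'0) /= addrC natr1 pnatr_eq0.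
by rewrite ger_pMr// ler_pdivrMr// mul1r ler_nat.
Qed.

Definition lipschitz_connective n (F : ('I_n -> R) -> R) (C : R)
    (FC : forall x y, `|F x - F y| <= C * \sum_j `|x j - y j|)
    (F01 : forall x, (forall j, 0 <= x j <= 1) -> 0 <= F x <= 1) :
  connective R 'I_n :=
  @Connective R 'I_n (F : {ptws 'I_n -> R} -> R)
    (continuous_subspaceT (lipschitz_continuous FC)) F01.

Lemma dist_min1 (x y : R) : `|Num.min 1 x - Num.min 1 y| <= `|x - y|.
Proof.
rewrite /Order.min; case: (ltP 1 x) => h1; case: (ltP 1 y) => h2 //.
- by rewrite subrr normr0.
- by rewrite !ger0_norm; lra.
- by rewrite distrC [leRHS]distrC !ger0_norm; lra.
Qed.

Lemma dist_fun_lipschitz n (v : 'I_n -> R) (x y : 'I_n -> R) :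
  `|Num.min 1 (\sum_j `|x j - v j|) - Num.min 1 (\sum_j `|y j - v j|)| <=
    1 * \sum_j `|x j - y j|.
Proof.
rewrite mul1r; apply: le_trans (dist_min1 _ _) _; rewrite -sumrB.
apply: le_trans (ler_norm_sum _ _ _) _; apply: ler_sum => j _.
by apply: le_trans (ler_dist_dist _ _) _; rewrite opprB addrA subrK.
Qed.

Lemma dist_fun_range n (v x : 'I_n -> R) :
  0 <= Num.min 1 (\sum_j `|x j - v j|) <= 1.
Proof. by rewrite le_min ler01 sumr_ge0//= ge_min lexx. Qed.

(** Types consist of conditions of the form chi = 0; this connective gives that form to the
    condition that each [x j] has the value [v j]. *)
Definition dist_connective n (v : 'I_n -> R) : connective R 'I_n :=
  lipschitz_connective (dist_fun_lipschitz v) (fun x _ => dist_fun_range v x).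

End LipschitzConnectives.

Section FiniteSets.

Lemma finite_set_list T (G : set T) : finite_set G ->
  exists s : seq T, forall x, G x <-> List.In x s.
Proof.
move=> /(@finite_seqP {classic T})[s ->]; exists s => x /=.
elim: s => [|y s IH] /=; first by rewrite in_nil.
rewrite in_cons; split.
  by move=> /orP[/eqP <-|/IH ?]; [left|right].
by move=> [<-|/IH ->]; rewrite ?eqxx ?orbT.
Qed.

Lemma filter_list T I (F : set_system T) (s : seq I) (S : I -> set T) : Filter F ->
  (forall i, List.In i s -> F (S i)) -> F [set x | forall i, List.In i s -> S i x].
Proof.
move=> FF; elim: s => [|i s IH] h; first by apply: filterS filterT => x _ j [].
have h1 := h i (or_introl erefl).
have h2 := IH (fun j hj => h j (or_intror hj)).
by apply: filterS (filterI h1 h2) => x [Sx sx] j [<-|/sx].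
Qed.

Lemma list_bounded T (s : seq T) (h : T -> nat) :
  exists k, forall x, List.In x s -> (h x < k)%N.
Proof.
elim: s => [|y s [k hk]]; first by exists 0%N.
by exists (maxn (h y).+1 k) => x [<-|/hk hx]; rewrite leq_max ?leqnn ?hx ?orbT.
Qed.

End FiniteSets.

Section Saturation.
Context {R : realType} {L : language R} (K : Type) (M : structure L).
Hypothesis sat : saturated K M.

(** The conditions [D chi] prescribe all limit values at once; finitely many of them are nearly
    satisfied by [a i] for almost all [i], so saturation realises them together. *)
Lemma saturated_ultralimit (A : set (elt M)) n (sv : 'I_n -> lsort L)
    I (U : set_system I) (a : I -> mtuple M sv) : UltraFilter U -> small K A ->
  exists c : mtuple M sv, forall chi : pformula A sv,
    ulim U (fun i => peval chi (a i)) (peval chi c).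
Proof.
move=> UU sA; have FU : ProperFilter U by exact: ultra_proper.
have [v hv] := choice (fun chi : pformula A sv =>
  ulim_exists UU (fun i => feval_range chi (mtuple_sum (a i) (@par_mtuple _ _ M A)))).
pose D chi : pformula A sv := Conn (dist_connective (fun _ : 'I_1 => v chi)) (fun=> chi).
have DE chi x : peval (D chi) x = Num.min 1 `|peval chi x - v chi|.
  by rewrite /peval /= big_ord1.
have [|c hc] := @sat A n sv (range D) sA.
  move=> G eps /finite_set_list[s Gs] GD eps0.
  have : U [set i | forall chi, List.In chi s -> peval chi (a i) <= eps].
    apply: (@filter_list _ _ _ s (fun chi => [set i | peval chi (a i) <= eps])).
    move=> chi /Gs/GD[chi' _ <-]; apply: filterS (hv chi' eps eps0) => i /=.
    by rewrite DE ge_min => ->; rewrite orbT.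
  by move=> /filter_ex[i hi]; exists (a i) => chi /Gs; exact: hi.
exists c => chi; have := hc (D chi) (ex_intro2 _ _ chi Logic.I erefl).
rewrite DE /Num.min; case: ltP => [_ /eqP|_ /eqP]; first by rewrite oner_eq0.
by rewrite normr_eq0 subr_eq0 => /eqP ->; exact: hv.
Qed.

Hypothesis countable_small : forall (A : set (elt M)), countable A -> small K A.

Section Sequence.
Variables (J : countType) (si : J -> lsort L).
Variables (I : Type) (U : set_system I) (t : I -> mtuple M si).
Hypothesis UU : UltraFilter U.

Definition supported_below k (chi : formula si) := forall e e' : mtuple M si,
  (forall j, (pickle j < k)%N -> e j = e' j) -> feval chi e = feval chi e'.

Definition realises_below k (c : mtuple M si) := forall chi, supported_below k chi ->
  ulim U (fun i => feval chi (t i)) (feval chi c).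

(** All variables but [j0] become the parameters chosen so far, and [j0] the only free variable.
    This leaves a type in finitely many variables, as [saturated] asks. *)
Definition par_subst (c : mtuple M si) (j0 : J) : forall j,
    term (ctx_sum (fun _ : 'I_1 => si j0)
            (@par_sort R L M (range (fun j => existT _ (si j) (c j))))) (si j) :=
  dfwith (fun j => Var (ctx_sum (fun _ : 'I_1 => si j0)
            (@par_sort R L M (range (fun j => existT _ (si j) (c j)))))
            (inr (exist _ (existT (fun s => M s) (si j) (c j)) (ex_intro2 _ _ j Logic.I erefl))))
    j0 (Var (ctx_sum (fun _ : 'I_1 => si j0) _) (inl ord0)).

(** [j0] becomes the variable that [Inf] is going to bind, and the others stay free. *)
Definition quant_subst (j0 : J) : forall j, term (ctx_ext (si j0) si) (si j) :=
  dfwith (fun j => Var (ctx_ext (si j0) si) (Some j)) j0 (Var (ctx_ext (si j0) si) None).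

Lemma teval_dfwith W (sw : W -> lsort L) (e : mtuple M sw) (j0 : J)
    (s : forall j, term sw (si j)) (u : term sw (si j0)) :
  (fun j => teval (dfwith s j0 u j) e) = dfwith (fun j => teval (s j) e) j0 (teval u e).
Proof.
apply: functional_extensionality_dep => j.
have [<-|jj0] := eqVneq j0 j; first by rewrite !dfwithin.
by rewrite !dfwithout.
Qed.

(* The new element has to satisfy the limit type over the elements already
   chosen; finite parts of it are witnessed by the values of a formula [xi] with
   one [Inf], which only involves these elements. *)
Lemma realises_below_step k c : realises_below k c ->
  exists2 c', realises_below k.+1 c' & forall j, (pickle j < k)%N -> c' j = c j.
Proof.
have FU : ProperFilter U by exact: ultra_proper.
move=> hc; have [[j0 j0k]|nok] := pselect (exists j0 : J, pickle j0 = k); last first.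
  exists c => // chi schi; apply: hc => e e' ee'; apply: schi => j.
  rewrite ltnS leq_eqVlt => /orP[/eqP h|]; last exact: ee'.
  by case: nok; exists j.
pose A := range (fun j => existT (fun s => M s) (si j) (c j)).
have sA : small K A.
  apply: countable_small; apply: (sub_countable (card_image_le _ _)); exact: countableP.
have [v hv] := choice (fun chi : formula si =>
  ulim_exists UU (fun i => feval_range chi (t i))).
pose D chi : pformula A (fun _ : 'I_1 => si j0) :=
  Conn (dist_connective (fun _ : 'I_1 => v chi)) (fun=> fsubst chi (par_subst c j0)).
have DE chi x : peval (D chi) x = Num.min 1 `|feval chi (dfwith c j0 (x ord0)) - v chi|.
  rewrite /peval /= big_ord1 feval_subst /par_subst teval_dfwith.
  by [].
have [|x hx] := @sat A 1%N _ (D @` supported_below k.+1) sA.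
  move=> G eps /finite_set_list[s Gs] GD eps0.
  have [s' hs' sG] : exists2 s' : seq (formula si),
      (forall chi, List.In chi s' -> supported_below k.+1 chi) &
      forall chi, List.In chi s -> exists2 chi', List.In chi' s' & D chi' = chi.
    have : forall chi, List.In chi s -> (D @` supported_below k.+1) chi.
      by move=> chi /Gs/GD.
    elim: (s) => [|chi s1 IH] h; first by exists nil.
    have [s2 h2 h2'] := IH (fun chi' h' => h chi' (or_intror h')).
    have [chi' h3 h3'] := h chi (or_introl erefl).
    exists (chi' :: s2); first by move=> ? [<-|/h2].
    move=> ? [<-|/h2'[chi4 ? ?]]; first by exists chi' => //; left.
    by exists chi4 => //; right.
  have [[chi0 _]|s'0] : (exists chi0 : formula si, True) \/ s' = nil.
  - by case: (s') => [|chi0 ?]; [right|left; exists chi0].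
  - pose N := size s'.
    pose F (i : 'I_N) := nth chi0 s' i.
    have FS i : supported_below k.+1 (F i).
      apply: hs'; rewrite /F; move: (ltn_ord i); rewrite /N; move: (nat_of_ord i).
      by elim: (s') => [//|y s1 IH] [|i'] /= h; [left|right; exact: IH].
    pose body := Conn (dist_connective (fun i => v (F i)))
      (fun i => fsubst (F i) (quant_subst j0)).
    pose xi : formula si := Inf body.
    have bodyE e (u : M (si j0)) : feval body (mtuple_ext u e) =
        Num.min 1 (\sum_i `|feval (F i) (dfwith e j0 u) - v (F i)|).
      rewrite /= ; congr (Num.min 1 _); apply: eq_bigr => i _.
      by rewrite feval_subst /quant_subst teval_dfwith.
    have xiE e : feval xi e =
        inf (range (fun u : M (si j0) => feval body (mtuple_ext u e))) by [].
    have lb e : has_lbound (range (fun u : M (si j0) => feval body (mtuple_ext u e))).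
      by exists 0 => _ [u _ <-]; have /andP[] := feval_range body (mtuple_ext u e).
    have sxi : supported_below k xi.
      move=> e e' ee'; rewrite !xiE; apply: (congr1 (fun F => inf (range F))); apply/funext => u.
      rewrite !bodyE; congr (Num.min 1 _); apply: eq_bigr => i _.
      congr (`| _ - _|); apply: FS => j hj.
      have [<-|jj0] := eqVneq j0 j; first by rewrite !dfwithin.
      rewrite !dfwithout//; apply: ee'; move: hj; rewrite ltnS leq_eqVlt -j0k.
      move=> /orP[/eqP/(pcan_inj pickleK) h|//]; by rewrite h eqxx in jj0.
    (* Along the ultrafilter the coordinate [t i j0] witnesses that [xi] is small, and [c] inherits
       this since [xi] involves only earlier variables. *)
    have xi0 : feval xi c <= eps / 2.
      apply: (ulim_le FU (hc _ sxi)).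
      have e0 : 0 < eps / 2 / N.+1%:R by rewrite !divr_gt0.
      have : U [set i | forall l : 'I_N, `|feval (F l) (t i) - v (F l)| <= eps / 2 / N.+1%:R].
        by apply: filter_forall => l; exact: hv.
      apply: filterS => i hi; rewrite /mkset xiE.
      apply: le_trans (ge_inf (lb (t i)) _) _.
        by exists (t i j0); last reflexivity.
      rewrite bodyE ge_min; apply/orP; right.
      apply: le_trans (_ : \sum_(l < N) (eps / 2 / N.+1%:R) <= _).
        apply: ler_sum => l _; rewrite (_ : dfwith _ _ _ = t i)//.
        apply: functional_extensionality_dep => j.
        have [<-|jj0] := eqVneq j0 j; first by rewrite dfwithin.
        by rewrite dfwithout.
      rewrite sumr_const card_ord -[leLHS]mulr_natr -mulrA ger_pMr ?divr_gt0//.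
      by rewrite mulrC ler_pdivrMr// mul1r ler_nat.
    have hi : has_inf (range (fun u : M (si j0) => feval body (mtuple_ext u c))).
      split => //; exists (feval body (mtuple_ext (c j0) c)); by exists (c j0).
    have e20 : 0 < eps / 2 by rewrite divr_gt0.
    have [_ [u _ <-] hu] := inf_adherent e20 hi.
    have {}hu : feval body (mtuple_ext u c) <= eps.
      apply: le_trans (ltW hu) _; move: xi0; rewrite xiE => xi0.
      by rewrite [leRHS](splitr eps) lerD2r.
    exists (fun=> u) => chi /Gs/sG[chi' chi's <-]; rewrite DE.
    apply: le_trans hu; rewrite bodyE.
    have [i ->] : exists i, chi' = F i.
      have [i iN ->] : exists2 i, (i < N)%N & chi' = nth chi0 s' i.
        rewrite /N; elim: (s') chi's => [//|y s1 IH] /= [<-|/IH[i ? ?]]; first by exists 0%N.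
        by exists i.+1.
      by exists (Ordinal iN).
    rewrite le_min !ge_min lexx/=; apply/orP; right.
    by rewrite (bigD1 i)//= lerDl sumr_ge0.
  - exists (fun=> c j0) => chi /Gs/sG[chi'].
    by rewrite s'0.
exists (dfwith c j0 (x ord0)).
  move=> chi schi; have := hx (D chi) (ex_intro2 _ _ chi schi erefl).
  rewrite DE /Num.min; case: ltP => [_ /eqP|_ /eqP]; first by rewrite oner_eq0.
  by rewrite normr_eq0 subr_eq0 => /eqP ->; exact: hv.
move=> j hj; rewrite dfwithout//; apply/eqP => h.
by move: hj; rewrite -h j0k ltnn.
Qed.

(** Elements are chosen one by one along [pickle]; a formula has finite support, so its limit value
    is secured at a finite stage and later choices do not alter it. *)
Lemma saturated_sequence : exists c : mtuple M si, forall chi,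
  ulim U (fun i => feval chi (t i)) (feval chi c).
Proof.
have FU : ProperFilter U by exact: ultra_proper.
have inh j : exists x : M (si j), True by have [x] := carrier_inh M (si j); exists x.
pose c0 : mtuple M si := fun j => sval (cid (inh j)).
have r0 : realises_below 0 c0.
  move=> chi schi e e0; apply: filterS filterT => i _ /=.
  by rewrite (schi (t i) c0)// subrr normr0 ltW.
pose stp k (c : {c | realises_below k c}) : {c' | realises_below k.+1 c' /\
    forall j, (pickle j < k)%N -> c' j = sval c j} :=
  cid ((exists2P _ _).1 (realises_below_step (svalP c))).
pose C := fix C k : {c | realises_below k c} :=
  if k is k'.+1 then exist _ (sval (stp k' (C k'))) (svalP (stp k' (C k'))).1
  else exist _ c0 r0.
have CS k j : (pickle j < k)%N -> sval (C k.+1) j = sval (C k) j.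
  by move=> h; rewrite /=; exact: (svalP (stp k (C k))).2.
pose c : mtuple M si := fun j => sval (C (pickle j).+1) j.
have cC k j : (pickle j < k)%N -> sval (C k) j = c j.
  elim: k => [//|k IH]; rewrite ltnS leq_eqVlt => /orP[/eqP h|h]; last by rewrite CS// IH.
  by rewrite /c h.
exists c => chi.
have [A /finite_set_list[s As] hA] := feval_support M chi.
have [k hk] := list_bounded s pickle.
have schi : supported_below k chi.
  by move=> e e' ee'; apply: hA => j /As/hk; exact: ee'.
by rewrite -(schi _ _ (cC k)); exact: (svalP (C k)).
Qed.

End Sequence.

(** The ladders of length [N] become a sequence of countable tuples [t N]; its limit along an
    ultrafilter containing the final segments of [nat] is an infinite ladder. *)
Lemma finite_ladders_order_property n m (sx : 'I_n -> lsort L) (sy : 'I_m -> lsort L)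
    (phi : formula (ctx_sum sx sy)) (d : R) : 0 < d ->
  (forall N, ladder (fun a b => feval phi (@mtuple_sum _ _ M _ _ sx sy a b)) d N) ->
  order_property M phi.
Proof.
move=> d0 lad.
have [a ha] := choice lad; have [y hy] := choice ha.
pose J : countType := (nat * ('I_n + 'I_m))%type.
pose si (p : J) : lsort L := ctx_sum sx sy p.2.
pose t N : mtuple M si := fun p => mtuple_sum (a N p.1) (y N p.1) p.2.
have [U [UU Uoo]] := @ultraFilterLemma nat \oo _.
have FU : ProperFilter U by exact: ultra_proper.
have [c hc] := @saturated_sequence J si nat U t UU.
pose F i j : formula si := fsubst phi (fun z => match z with
  | inl v => Var si (i, inl v) | inr w => Var si (j, inr w) end).
have FE e i j : feval (F i j) e = feval phi (mtuple_sum
    (fun v => e (i, inl v) : M (sx v)) (fun w => e (j, inr w) : M (sy w))).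
  by rewrite feval_subst; congr feval; apply: functional_extensionality_dep => -[].
exists d, (fun i v => c (i, inl v)), (fun j w => c (j, inr w)); split => // i j ij.
rewrite -!FE; apply: (ulim_dist_ge FU (hc (F i j)) (hc (F j i))).
apply: Uoo; exists j.+1 => // N /= jN; rewrite !FE.
by apply: hy; rewrite ij.
Qed.

End Saturation.

(** * Small sets *)

Section Cardinals.

(* Zorn's lemma for the graphs [G] of injections [D * nat -> D] with [D] a subset
   of [S]; for a maximal one, [S] without [D] is finite. *)
Lemma infinite_absorbs_nat T (S : set T) : infinite_set S ->
  exists h : T * nat -> T, (forall p, S p.1 -> S (h p)) /\
    forall p q, S p.1 -> S q.1 -> h p = h q -> p = q.
Proof.
move=> infS.
(* [G] is the graph of an injection whose values belong to its own set of first coordinates; a first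
   coordinate occurs with every [k]. *)
pose ok (G : set ((T * nat) * T)) := [/\
  forall p x y, G (p, x) -> G (p, y) -> x = y,
  forall p q x, G (p, x) -> G (q, x) -> p = q,
  forall p x, G (p, x) -> forall k, exists y, G ((x, k), y) &
  forall p x, G (p, x) -> [/\ S p.1, S x & forall k, exists y, G ((p.1, k), y)]].
have [F Fok totF|G [okG maxG]] := @Zorn_bigcup _ ok.
  have both u v : (\bigcup_(X in F) X) u -> (\bigcup_(X in F) X) v ->
      exists X, [/\ F X, X u & X v].
    move=> [X FX Xu] [Y FY Yv]; have [XY|YX] := totF _ _ FX FY.
      by exists Y; split => //; exact: XY.
    by exists X; split => //; exact: YX.
  split.
  - move=> p x y hx hy; have [X [/Fok[h _ _ _] Xx Xy]] := both _ _ hx hy.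
    exact: h Xx Xy.
  - move=> p q x hp hq; have [X [/Fok[_ h _ _] Xx Xy]] := both _ _ hp hq.
    exact: h Xx Xy.
  - move=> p x [X FX Xx] k; have [_ _ h _] := Fok _ FX.
    by have [y hy] := h _ _ Xx k; exists y; exists X.
  - move=> p x [X FX Xx]; have [_ _ _ h] := Fok _ FX.
    have [Sp Sx hp] := h _ _ Xx; split => // k.
    by have [y hy] := hp k; exists y; exists X.
have [funG injG rngG domG] := okG.
pose D := [set x | exists k y, G ((x, k), y)].
have DS : D `<=` S by move=> x [k [y /domG[]]].
have finD : finite_set (S `\` D).
  apply: contrapT => /infiniteP/(@card_leP nat)[e].
  pose u (k : nat) : T := val (e (exist _ k (mem_set Logic.I)) : set_type (S `\` D)).
  have uinj : injective u.
    by move=> i j /val_inj/(@inj _ _ _ e) -/(_ (mem_set Logic.I) (mem_set Logic.I)) [].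
  have uS k : S (u k) /\ ~ D (u k).
    by have := set_valP (e (exist _ k (mem_set Logic.I))).
  (* An infinite sequence [u] outside [D] would carry an injection of its own, by a pairing
     function, and so enlarge [G]. *)
  pose N := [set w : (T * nat) * T | exists (i k : nat), w = ((u i, k), u (pickle (i, k)))].
  have okGN : ok (G `|` N).
    split.
    - move=> p x y [Gx|[i [k [-> ->]]]] [Gy|[i' [k' e']]].
      + exact: funG Gx Gy.
      + case: e' => e' _; rewrite e' in Gx.
        by case: (uS i').2; exists k', x.
      + by case: (uS i).2; exists k, y.
      + by case: e' => /uinj -> -> ->.
    - move=> p q x [Gx|[i [k [-> ->]]]] [Gy|[i' [k' e']]].
      + exact: injG Gx Gy.
      + case: e' => _ e'; rewrite e' in Gx.
        case: (uS (pickle (i', k'))).2.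
        by have [y hy] := rngG _ _ Gx 0%N; exists 0%N, y.
      + case: (uS (pickle (i, k))).2.
        by have [y hy] := rngG _ _ Gy 0%N; exists 0%N, y.
      + by case: e' => -> /uinj/(pcan_inj pickleK) [-> ->].
    - move=> p x [Gx|[i [k [_ ->]]]] l.
        by have [y hy] := rngG _ _ Gx l; exists y; left.
      by exists (u (pickle (pickle (i, k), l))); right; exists (pickle (i, k)), l.
    - move=> p x [Gx|[i [k [-> ->]]]].
        have [Sp Sx hp] := domG _ _ Gx; split => // l.
        by have [y hy] := hp l; exists y; left.
      split; [exact: (uS i).1|exact: (uS _).1|move=> l].
      by exists (u (pickle (i, l))); right; exists i, l.
  apply: maxG okGN; split; first by move=> w Gw; left.
  move=> /(_ _ (or_intror (ex_intro _ 0%N (ex_intro _ 0%N erefl)))) G0.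
  by apply: (uS 0%N).2; exists 0%N, (u (pickle (0%N, 0%N))).
have [d Dd] : D !=set0.
  apply: contrapT => nD; apply: infS; apply: sub_finite_set finD => x Sx.
  by split => // Dx; apply: nD; exists x.
have dom x k : D x -> exists y, G ((x, k), y).
  by move=> [l [y /domG[_ _ /(_ k)]]].
have /choice[h hh] : forall p : T * nat, exists y, D p.1 -> G (p, y).
  move=> [x k]; have [Dx|nDx] := pselect (D x); last by exists x.
  by have [y hy] := dom x k Dx; exists y.
have hD p : D p.1 -> D (h p).
  by move=> /hh/rngG/(_ 0%N)[y hy]; exists 0%N, y.
have hinj p q : D p.1 -> D q.1 -> h p = h q -> p = q.
  by move=> /hh h1 /hh h2 e; rewrite e in h1; exact: injG h1 h2.
have /countable_injP[c cinj] := finite_set_countable finD.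
(* The finite remainder of [S] goes to the fibre of one point [d]; the successor keeps it clear of
   the pairs [(x, 0)] used for the points of [D]. *)
pose j x := if pselect (D x) then (x, 0%N) else (d, (c x).+1).
have jD x : D (j x).1 by rewrite /j; case: pselect.
have jinj x y : S x -> S y -> j x = j y -> x = y.
  move=> Sx Sy; rewrite /j; case: pselect => Dx; case: pselect => Dy //.
    by case.
  by move=> [] /cinj; apply; rewrite inE.
exists (fun p => h (h (j p.1), p.2)); split.
  by move=> p Sp; apply/DS/hD/hD/jD.
move=> [x k] [y l] /= Sx Sy /hinj -/(_ (hD _ (jD x)) (hD _ (jD y))) [/hinj + ->].
by move=> /(_ (jD x) (jD y)) /(jinj _ _ Sx Sy) ->.
Qed.

(** [code o k x] makes [x] the [k]-th element attached to [o], where [None] stands for a countable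
    stock besides [B]. This embeds [A] into [(1 + B) * nat], which is countable for finite [B] and
    embeds into [B] otherwise. *)
Lemma small_coded (K T U : Type) (B : set T) (A : set U)
    (code : option T -> nat -> U -> Prop) :
  small K [set: nat] -> small K B ->
  (forall o k x y, code o k x -> code o k y -> x = y) ->
  (forall x, A x -> exists o k, code o k x /\ forall c, o = Some c -> B c) ->
  small K A.
Proof.
move=> sN sB codef codeA; rewrite /small; apply/negP => KA.
have /choice[F hF] : forall x, exists p : option T * nat,
    A x -> code p.1 p.2 x /\ forall c, p.1 = Some c -> B c.
  move=> x; have [Ax|nAx] := pselect (A x); last by exists (None, 0%N).
  by have [c [k h]] := codeA x Ax; exists (c, k).
have Finj x y : A x -> A y -> F x = F y -> x = y.
  move=> /hF[h1 _] /hF[h2 _] e; rewrite e in h1; exact: codef h1 h2.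
have [finB|infB] := pselect (finite_set B).
  move/negP: sN; apply; apply: card_le_trans KA _.
  have /countable_injP[c cinj] := finite_set_countable finB.
  apply/countable_injP; exists (fun x => pickle (omap c (F x).1, (F x).2)) => x y.
  rewrite !inE => Ax Ay /(pcan_inj pickleK) [e1 e2]; apply: Finj => //.
  have [_ BFx] := hF _ Ax; have [_ BFy] := hF _ Ay.
  move: (F x) (F y) e1 e2 BFx BFy => [[a|] k] [[b|] l] //= e1 -> ha hb //.
  by case: e1 => /cinj ->//; rewrite inE; [exact: ha|exact: hb].
have [h [hB hinj]] := infinite_absorbs_nat infB.
have [b0 Bb0] := infinite_setN0 infB.
(* Even numbers code the case [Some], odd numbers the case [None], which is attached to [b0]. *)
pose E x := if (F x).1 is Some c then h (c, (F x).2.*2) else h (b0, (F x).2.*2.+1).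
move/negP: sB; apply; apply: card_le_trans KA _.
have Einj : {in A &, injective E}.
  move=> x y; rewrite !inE => Ax Ay; rewrite /E => e; apply: Finj => //; move: e.
  have [_ BFx] := hF _ Ax; have [_ BFy] := hF _ Ay.
  move: (F x) (F y) BFx BFy => [[a|] k] [[b|] l] /= BFx BFy /hinj.
  - by move=> /(_ (BFx _ erefl) (BFy _ erefl)) [-> /double_inj ->].
  - by move=> /(_ (BFx _ erefl) Bb0) [_ e]; exfalso; lia.
  - by move=> /(_ Bb0 (BFy _ erefl)) [_ e]; exfalso; lia.
  - by move=> /(_ Bb0 Bb0) [/double_inj ->].
apply: card_le_trans (_ : E @` A #<= B).
  by have := inj_card_eq Einj; rewrite card_eq_le => /andP[].
apply: subset_card_le => _ [x Ax <-]; rewrite /E.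
have [_ ] := hF _ Ax; case: (F x).1 => [c|] hc; apply: hB => //=.
exact: hc.
Qed.

Lemma countable_small (K T : Type) (A : set T) :
  small K [set: nat] -> countable A -> small K A.
Proof.
move=> sN cA; apply/negP => KA; move/negP: sN; apply; exact: card_le_trans KA cA.
Qed.

End Cardinals.

(** * Invariant averages *)

Section Averages.
Context {R : realType}.

Lemma avg_dist Q (h : Q -> R) (s : seq Q) (c e : R) : (0 < size s)%N ->
  (forall x, List.In x s -> `|c - h x| <= e) -> `|c - avg h s| <= e.
Proof.
move=> s0 hs; have n0 : 0 < (size s)%:R :> R by rewrite ltr0n.
have H : `|c * (size s)%:R - \sum_(y <- s) h y| <= e * (size s)%:R.
  elim: s {s0 n0} hs => [|x s IH] hs; first by rewrite big_nil !mulr0 subrr normr0.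
  rewrite big_cons /= -add1n natrD !mulrDr !mulr1 opprD addrACA.
  apply: le_trans (ler_normD _ _) (lerD (hs _ (or_introl erefl)) (IH _)).
  by move=> y hy; apply: hs; right.
rewrite /avg -(ler_pM2r n0); apply: le_trans H.
rewrite -[X in _ * X <= _](ger0_norm (ltW n0)) -normrM mulrBl divfK//.
by rewrite gt_eqF.
Qed.

Lemma avg_dist2 Q (h h' : Q -> R) (s : seq Q) (e : R) : (0 < size s)%N ->
  (forall x, List.In x s -> `|h x - h' x| <= e) -> `|avg h s - avg h' s| <= e.
Proof.
move=> s0 hs.
have := @avg_dist Q (fun x => h' x - h x) s 0 e s0.
rewrite /avg big_split/= sumrN mulrBl sub0r opprB; apply.
by move=> x /hs; rewrite sub0r opprB.
Qed.

Lemma avgC P Q (f : P -> Q -> R) s t :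
  avg (fun a => avg (f a) t) s = avg (fun y => avg (fun a => f a y) s) t.
Proof.
rewrite /avg -!mulr_suml exchange_big /= mulrAC; congr (_ * _ * _).
Qed.

Lemma avg_ge0 Q (h : Q -> R) s : (forall x, 0 <= h x) -> 0 <= avg h s.
Proof. by move=> h0; rewrite /avg divr_ge0// sumr_ge0. Qed.

Lemma In_nth T (x0 : T) s x : List.In x s -> exists2 i, (i < size s)%N & x = nth x0 s i.
Proof.
elim: s => [//|y s IH] /= [<-|/IH[i ? ?]]; first by exists 0%N.
by exists i.+1.
Qed.

Lemma nth_In T (x0 : T) s i : (i < size s)%N -> List.In (nth x0 s i) s.
Proof. by elim: s i => [//|y s IH] [|i] /= h; [left|right; exact: IH]. Qed.

End Averages.

(** * Conjugacy under automorphisms *)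

Section Conjugacy.
Context {R : realType} {L : language R} {M : structure L}.
Context {n : nat} {sx : 'I_n -> lsort L}.
Implicit Types B : set (mtuple M sx).

Definition aut_over B (g : forall s, M s -> M s) :=
  automorphism g /\ forall c, B c -> act_tuple g c = c.

(** By homogeneity this is [equiv_over (coords B)] for finite tuples and small [B]; as an orbit
    relation it is what the averaging argument applies to. *)
Definition conj_over B V (sv : V -> lsort L) (e e' : mtuple M sv) :=
  exists2 g, aut_over B g & act_tuple g e = e'.

Lemma conj_refl B V (sv : V -> lsort L) (e : mtuple M sv) : conj_over B e e.
Proof. by exists (fun s x => x) => //; split => //; split => // s; exists id. Qed.

Lemma conj_sub B B' V (sv : V -> lsort L) (e e' : mtuple M sv) :
  B `<=` B' -> conj_over B' e e' -> conj_over B e e'.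
Proof. by move=> BB' [g [ag gB] <-]; exists g => //; split => // c /BB'/gB. Qed.

Lemma conj_act B g V (sv : V -> lsort L) (e e' : mtuple M sv) :
  aut_over B g -> conj_over B e e' -> conj_over B e (act_tuple g e').
Proof.
move=> [ag gB] [h [ah hB] <-]; exists (fun s x => g s (h s x)) => //; split.
  split.
  - by move=> s; apply: bij_comp (aut_bij ag s) (aut_bij ah s).
  - by move=> s x y; rewrite (aut_dist ag) (aut_dist ah).
  - by move=> f x; rewrite (aut_fint ag (fun k => h _ (x k))) (aut_fint ah).
  - by move=> p x; rewrite (aut_pint ag (fun k => h _ (x k))) (aut_pint ah).
by move=> c Bc; rewrite -[RHS](gB c Bc) -[in RHS](hB c Bc).
Qed.

Lemma act_sum g V W (sv : V -> lsort L) (sw : W -> lsort L) (e : mtuple M sv)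
  (d : mtuple M sw) : act_tuple g (mtuple_sum e d) = mtuple_sum (act_tuple g e) (act_tuple g d).
Proof. by apply: functional_extensionality_dep => -[]. Qed.

Lemma aut_over_coords B g p : aut_over B g -> coords B p -> g _ (projT2 p) = projT2 p.
Proof. by move=> [_ gB] [c Bc [v ->]] /=; rewrite -[in RHS](gB c Bc). Qed.

Lemma conj_equiv B V (sv : V -> lsort L) (e e' : mtuple M sv) :
  conj_over B e e' -> equiv_over (coords B) e e'.
Proof.
move=> [g gB <-] chi; rewrite /peval -(feval_aut chi _ gB.1) act_sum.
congr (feval chi (mtuple_sum _ _)); apply: functional_extensionality_dep => p.
exact: aut_over_coords (svalP p).
Qed.

Context {K : Type}.
Hypothesis sN : small K [set: nat].

(** Homogeneity is applied to [e] and [e'], each followed by all parameters from [B]: an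
    automorphism matching these tuples fixes the parameters. *)
Lemma equiv_conj B k (sv : 'I_k -> lsort L) (e e' : mtuple M sv) :
  strongly_homogeneous K M -> small K B ->
  equiv_over (coords B) e e' -> conj_over B e e'.
Proof.
move=> hom sB ee'.
have sI : small K [set: 'I_k + {p | coords B p}].
  apply: (@small_coded K _ _ B _ (fun o l x => match o with
    | Some c => exists v : 'I_n, l = v /\ exists2 p, x = inr p & sval p = existT _ (sx v) (c v)
    | None => exists i : 'I_k, l = i /\ x = inl i end)) => //.
  - case=> [c|] l x y.
      move=> [v [-> [p -> pv]]] [v' [/ord_inj <- [q -> qv]]].
      case: p q pv qv => [p hp] [q hq] /= pv qv.
      by subst p q; rewrite (Prop_irrelevance hp hq).
    by move=> [i [-> ->]] [j [/ord_inj -> ->]].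
  - move=> [i|[p hp]] _; first by exists None, i; split => //; exists i.
    have [c Bc [v pv]] := hp; exists (Some c), v; split; last by move=> c' [<-].
    by exists v; split => //; exists (exist _ p hp).
have [g ag gI] := hom _ _ (mtuple_sum e (@par_mtuple _ _ M (coords B)))
  (mtuple_sum e' (@par_mtuple _ _ M (coords B))) sI ee'.
exists g; last by apply: functional_extensionality_dep => v; exact: (gI (inl v)).
split => // c Bc; apply: functional_extensionality_dep => v.
have hp : coords B (existT _ (sx v) (c v)) by exists c => //; exists v.
exact: (gI (inr (exist _ _ hp))).
Qed.

End Conjugacy.

Lemma invS_le (R : realType) (d : R) : 0 < d -> exists k : nat, k.+1%:R^-1 <= d.
Proof.
move=> d0; have dV0 : 0 < d^-1 by rewrite invr_gt0.
exists (Num.bound d^-1); rewrite -[leRHS]invrK lef_pV2 ?posrE//.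
by apply: le_trans (ltW (archi_boundP (ltW dV0))) _; rewrite ler_nat.
Qed.

(** * The invariant predicate and its dependence on the base *)

Section InvariantAverage.
Context {R : realType} {L : language R} {T : set (sentence L)} {K : Type}.
Context {M : structure L} (hM : monster K M T).
Context {n m : nat} {sx : 'I_n -> lsort L} {sy : 'I_m -> lsort L}.
Variable phi : formula (ctx_sum sx sy).
Hypothesis hphi : stable T phi.

Let sN := monster_uncountable hM.

Definition value (a : mtuple M sx) (y : mtuple M sy) : R := feval phi (mtuple_sum a y).
Definition valueT y a := value a y.

Implicit Types B : set (mtuple M sx).

Lemma value_range a y : 0 <= value a y <= 1.
Proof. exact: feval_range. Qed.

Lemma value_act g a y : automorphism g ->
  value (act_tuple g a) (act_tuple g y) = value a y.
Proof. by move=> ag; rewrite /value -act_sum feval_aut. Qed.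

Lemma value_no_ladder d : 0 < d -> exists N, ~ ladder value d N.
Proof.
move=> d0; apply: contrapT => /forallNP h.
apply: (hphi (monster_models hM)).
apply: (finite_ladders_order_property (monster_saturated hM) _ d0).
  by move=> A; exact: countable_small.
by move=> N; apply: contrapT; exact: h.
Qed.

Lemma valueT_no_ladder d : 0 < d -> exists N, ~ ladder valueT d N.
Proof.
move=> /value_no_ladder[N hN]; exists N => -[y [a h]]; apply: hN.
by exists a, y => i j ij; rewrite distrC; exact: h.
Qed.

Definition approx_invariant V W (sv : V -> lsort L) (sw : W -> lsort L)
    (f : mtuple M sv -> mtuple M sw -> R) B (b : mtuple M sw) (e : R)
    (s : seq (mtuple M sw)) :=
  [/\ (0 < size s)%N, forall y, List.In y s -> conj_over B b y &
      forall a a', conj_over B a a' -> `|avg (f a) s - avg (f a') s| <= e].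

Lemma approx_invariant_exists V W (sv : V -> lsort L) (sw : W -> lsort L)
    (f : mtuple M sv -> mtuple M sw -> R) B b (e : R) :
  (forall a y, 0 <= f a y <= 1) ->
  (forall g a y, automorphism g -> f (act_tuple g a) (act_tuple g y) = f a y) ->
  (forall d, 0 < d -> exists N, ~ ladder f d N) -> 0 < e ->
  exists s, approx_invariant f B b e s.
Proof.
move=> f01 fact nolad e0.
have [||s [s0 sO hs]] := @approx_invariant_avg R _ _ f f01 {g | aut_over B g}
  (fun g c => act_tuple (sval g) c) (fun g c => act_tuple (sval g) c)
  (fun g a y => fact (sval g) a y (svalP g).1) (conj_over B b) b e nolad (conj_refl _ _).
- by move=> g y; exact: conj_act (svalP g).
- exact: e0.
- exists s; split => // a _ [g gB <-]; exact: (hs (exist _ g gB)).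
Qed.

Let exists_s B b e : 0 < e -> exists s, approx_invariant value B b e s.
Proof. exact: approx_invariant_exists value_range value_act value_no_ladder. Qed.

Let exists_t B a e : 0 < e -> exists t, approx_invariant valueT B a e t.
Proof.
apply: approx_invariant_exists valueT_no_ladder.
  by move=> *; exact: value_range.
by move=> *; exact: value_act.
Qed.

(* Harrington's symmetry: both sides are close to the double average. *)
Lemma approx_invariant_sym B a b e e' s t : approx_invariant value B b e s ->
  approx_invariant valueT B a e' t ->
  `|avg (value a) s - avg (valueT b) t| <= e + e'.
Proof.
move=> [s0 sb hs] [t0 ta ht].
rewrite -(subrKA (avg (fun a' => avg (value a') s) t)).
apply: le_trans (ler_normD _ _) (lerD _ _).
  by apply: avg_dist => // a' /ta; exact: hs.
rewrite avgC distrC; apply: avg_dist => // y /sb; exact: ht.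
Qed.

(* The common limit of the averages over all approximately invariant families. *)
Definition inv_avg B b a : R := inf [set r | exists s e,
  [/\ 0 < e, approx_invariant value B b e s & r = avg (value a) s + e]].

(** All averages entering the infimum agree up to the sum of their errors, since each is close to
    one and the same average of conjugates of [a] by [approx_invariant_sym]. *)
Lemma inv_avg_dist B b a e s : 0 < e -> approx_invariant value B b e s ->
  `|inv_avg B b a - avg (value a) s| <= e.
Proof.
move=> e0 hs; rewrite /inv_avg; set S := [set _ | _].
have lbS : has_lbound S.
  exists 0 => _ [s' [e' [e'0 _ ->]]]; rewrite addr_ge0 ?(ltW e'0)//.
  by apply: avg_ge0 => y; have /andP[] := value_range a y.
have Ss : S (avg (value a) s + e) by exists s, e.
rewrite ler_norml lerBlDl lerBrDl; apply/andP; split; last exact: ge_inf.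
apply: lb_le_inf; first by exists (avg (value a) s + e).
move=> _ [s' [e' [e'0 hs' ->]]]; apply/ler_addgt0Pr => d d0.
have d20 : 0 < d / 2 by rewrite divr_gt0.
have [t ht] := exists_t B a d20.
have := approx_invariant_sym hs ht; have := approx_invariant_sym hs' ht.
by rewrite !ler_norml => /andP[h1 h2] /andP[h3 h4]; lra.
Qed.

Lemma inv_avg_mem B b a : B a -> inv_avg B b a = value a b.
Proof.
move=> Ba; apply/eqP; rewrite -subr_eq0 -normr_le0.
apply/ler_addgt0Pr => d d0; rewrite add0r.
have d20 : 0 < d / 2 by rewrite divr_gt0.
have [s hs] := exists_s B b d20.
have h1 := inv_avg_dist a d20 hs; have [s0 sb _] := hs.
have h2 : `|value a b - avg (value a) s| <= 0.
  apply: avg_dist => // y /sb[g [ag /(_ _ Ba) ga] <-].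
  by rewrite -{2}ga value_act// subrr normr0.
by move: h1 h2; rewrite !ler_norml => /andP[h1 h2] /andP[h3 h4]; lra.
Qed.

Lemma inv_avg_range B b a : 0 <= inv_avg B b a <= 1.
Proof.
have H d : 0 < d -> - d <= inv_avg B b a <= 1 + d.
  move=> d0; have [s hs] := exists_s B b d0.
  have := inv_avg_dist a d0 hs; have [s0 _ _] := hs.
  have : `|2^-1 - avg (value a) s| <= 2^-1 :> R.
    apply: avg_dist => // y _; have /andP[h1 h2] := value_range a y.
    by rewrite ler_norml; lra.
  by rewrite !ler_norml => /andP[h1 h2] /andP[h3 h4]; lra.
apply/andP; split; apply/ler_addgt0Pr => d /H/andP[]; lra.
Qed.

(* Only instances of [phi] at conjugates of [b] over [B] enter [inv_avg B b];
   conjugates over [B] are also conjugates over the smaller [B0]. *)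
Lemma inv_avg_sub B0 B b e : B0 `<=` B ->
  (forall a a', conj_over B0 a a' -> `|inv_avg B b a - inv_avg B b a'| <= e) ->
  forall a, `|inv_avg B0 b a - inv_avg B b a| <= e.
Proof.
move=> BB he a; apply/ler_addgt0Pr => d d0.
(* Two of the five parts go to [h2] and one each to [h1], [h4] and [h5]; both sides are compared
   with a double average over [s] and [t]. *)
have d50 : 0 < d / 5 by rewrite divr_gt0.
have [t ht] := exists_t B0 a d50; have [s hs] := exists_s B b d50.
have [s' hs'] := exists_s B0 b d50.
have [t0 ta tinv] := ht; have [s0 sb _] := hs.
have h1 := inv_avg_dist a d50 hs'; have h2 := approx_invariant_sym hs' ht.
have h3 : `|inv_avg B b a - avg (inv_avg B b) t| <= e.
  by apply: avg_dist => // a' /ta; exact: he.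
have h4 : `|avg (inv_avg B b) t - avg (fun a' => avg (value a') s) t| <= d / 5.
  by apply: avg_dist2 => // a' _; exact: inv_avg_dist.
have h5 : `|avg (valueT b) t - avg (fun a' => avg (value a') s) t| <= d / 5.
  by rewrite avgC; apply: avg_dist => // y /sb/(conj_sub BB); exact: tinv.
move: h1 h2 h3 h4 h5; rewrite !ler_norml.
by move=> /andP[? ?] /andP[? ?] /andP[? ?] /andP[? ?] /andP[? ?]; lra.
Qed.

(** Compactness: pairs violating this for ever more formulas and ever smaller [d] have limits [c]
    and [c'] of the same type over [B]. These are conjugate, so an approximately invariant average
    hardly separates them, nor then the pairs close to them. *)
Lemma inv_avg_separation B b e : small K B -> 0 < e ->
  exists (F : seq (pformula (coords B) sx)) (d : R), 0 < d /\
    forall a a', (forall chi, List.In chi F -> `|peval chi a - peval chi a'| <= d) ->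
      `|inv_avg B b a - inv_avg B b a'| <= e.
Proof.
move=> sB e0; have e50 : 0 < e / 5 by rewrite divr_gt0.
have [s hs] := exists_s B b e50.
(* The members of [s] are included as parameters so that the limits also preserve [value a y] for
   [y] in [s]. *)
pose C : set (elt M) := coords B `|` coords [set y | List.In y s].
have sC : small K C.
  apply: (@small_coded K _ _ B _ (fun o l p => match o with
    | Some c => exists v : 'I_n, l = v /\ p = existT (fun s => M s) (sx v) (c v)
    | None => exists (j : nat) (w : 'I_m), l = pickle (j, w) /\
         p = existT (fun s => M s) (sy w) (nth b s j w) end)) => //.
  - case=> [c|] l x y; first by move=> [v [-> ->]] [v' [/ord_inj <- ->]].
    by move=> [j [w [-> ->]]] [j' [w' [/(pcan_inj pickleK)[<- <-] ->]]].
  - move=> p [[c Bc [v ->]]|[y /(In_nth b)[j _ ->] [w ->]]].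
      by exists (Some c), v; split; [exists v|move=> ? [<-]].
    by exists None, (pickle (j, w)); split => //; exists j, w.
apply: contrapT => H.
pose W (q : seq (pformula (coords B) sx) * nat) := [set aa : mtuple M sx * mtuple M sx |
  e < `|inv_avg B b aa.1 - inv_avg B b aa.2| /\
  forall chi, List.In chi q.1 -> `|peval chi aa.1 - peval chi aa.2| <= q.2.+1%:R^-1].
have W0 q : W q !=set0.
  apply: contrapT => nW; apply: H; exists q.1, q.2.+1%:R^-1; split => // a a' h.
  by rewrite leNgt; apply/negP => h'; apply: nW; exists (a, a').
have FW : ProperFilter (filter_from setT W).
  apply: filter_from_proper; last by move=> q _; exact: W0.
  apply: filter_from_filter; first by exists (nil, 0%N).
  move=> [F k] [F' k'] _ _; exists (F ++ F', (k + k')%N) => //= aa [h1 h2].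
  have le i j : (i <= j)%N -> j.+1%:R^-1 <= i.+1%:R^-1 :> R.
    by move=> ij; rewrite lef_pV2 ?posrE ?ltr0n// ler_nat.
  split; split => //= chi hchi.
    by apply: le_trans (h2 chi _) (le _ _ (leq_addr _ _)); apply: List.in_or_app; left.
  by apply: le_trans (h2 chi _) (le _ _ (leq_addl _ _)); apply: List.in_or_app; right.
have [U [UU WU]] := ultraFilterLemma FW.
have FU : ProperFilter U by exact: ultra_proper.
have [c hc] := saturated_ultralimit (monster_saturated hM) fst UU sC.
have [c' hc'] := saturated_ultralimit (monster_saturated hM) snd UU sC.
pose up (chi : pformula (coords B) sx) : pformula C sx := fsubst chi (fun z =>
  match z return term (ctx_sum sx (@par_sort _ _ M C)) (ctx_sum sx (@par_sort _ _ M (coords B)) z) with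
  | inl v => Var (ctx_sum sx (@par_sort _ _ M C)) (inl v)
  | inr p => Var (ctx_sum sx (@par_sort _ _ M C))
      (inr (exist _ (sval p) (or_introl (svalP p)))) end).
have upE chi a : peval (up chi) a = peval chi a.
  rewrite /peval feval_subst; congr feval.
  by apply: functional_extensionality_dep => -[].
have cc' : conj_over B c c'.
  apply: (equiv_conj sN (monster_homogeneous hM) sB) => chi.
  apply/eqP; rewrite -subr_eq0 -normr_le0; apply/ler_addgt0Pr => d d0; rewrite add0r.
  have d30 : 0 < d / 3 by rewrite divr_gt0.
  have [k hk] := invS_le d30.
  have hW : U (W ([:: chi], k)) by apply: WU; exists ([:: chi], k).
  have [aa [[h1 h2] [_ h3]]] := filter_ex (filterI (filterI (hc (up chi) _ d30)
    (hc' (up chi) _ d30)) hW).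
  have {}h3 := le_trans (h3 chi (or_introl erefl)) hk.
  move: h1 h2 h3; rewrite /mkset !upE /= !ler_norml.
  by move=> /andP[? ?] /andP[? ?] /andP[? ?]; lra.
have Cy y : List.In y s -> forall w, C (existT (fun s => M s) (sy w) (y w)).
  by move=> ys w; right; exists y => //; exists w.
have vlim y : List.In y s ->
    U [set aa | `|value aa.1 y - value c y| <= e / 5 /\ `|value aa.2 y - value c' y| <= e / 5].
  move=> ys; pose chi : pformula C sx := fsubst phi (fun z =>
    match z return term (ctx_sum sx (@par_sort _ _ M C)) (ctx_sum sx sy z) with
    | inl v => Var (ctx_sum sx (@par_sort _ _ M C)) (inl v)
    | inr w => Var (ctx_sum sx (@par_sort _ _ M C)) (inr (exist _ _ (Cy y ys w))) end).
  have chiE a : peval chi a = value a y.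
    rewrite /peval feval_subst; congr feval.
    by apply: functional_extensionality_dep => -[].
  apply: filterS (filterI (hc chi _ e50) (hc' chi _ e50)) => aa [].
  by rewrite /mkset !chiE => h h'; split.
have hW : U (W (nil, 0%N)) by apply: WU; exists (nil, 0%N).
have := filter_list FU vlim; move=> /(filterI hW)/filter_ex[aa [[h1 _] h2]].
have [s0 _ /(_ _ _ cc') h3] := hs.
have h4 : `|avg (value aa.1) s - avg (value c) s| <= e / 5.
  by apply: avg_dist2 => // y /h2[].
have h5 : `|avg (value aa.2) s - avg (value c') s| <= e / 5.
  by apply: avg_dist2 => // y /h2[].
have h6 := inv_avg_dist aa.1 e50 hs; have h7 := inv_avg_dist aa.2 e50 hs.
move: h1; rewrite ltNge => /negP; apply.
move: h3 h4 h5 h6 h7; rewrite !ler_norml.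
by move=> /andP[? ?] /andP[? ?] /andP[? ?] /andP[? ?] /andP[? ?]; lra.
Qed.

(** A formula uses finitely many parameters, each a coordinate of some tuple in [B]; automorphisms
    fixing these tuples preserve its values. *)
Lemma peval_finite_parameters B (chi : pformula (coords B) sx) :
  exists F : set (mtuple M sx), [/\ finite_set F, F `<=` B &
    forall a a', conj_over F a a' -> peval chi a = peval chi a'].
Proof.
have [A /finite_set_list[s As] hA] := feval_support M chi.
have [F [finF FB hF]] : exists F : set (mtuple M sx), [/\ finite_set F, F `<=` B &
    forall p, List.In (inr p) s -> coords F (sval p)].
  elim: (s) => [|z l [F [finF FB hF]]]; first by exists set0; split.
  case: z => [v|p]; first by exists F; split => // p [//|/hF].
  have [c Bc [v pv]] := svalP p.
  exists (F `|` [set c]); split; first by rewrite finite_setU.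
    by move=> c' [/FB//|->].
  move=> q [[<-]|/hF[c' Fc' [w ->]]]; first by exists c; [right|exists v].
  by exists c'; [left|exists w].
exists F; split => // a _ [g gF <-]; rewrite /peval -(feval_aut chi _ gF.1) act_sum.
apply: hA => -[v _ //|p /As/hF h] /=.
exact: aut_over_coords h.
Qed.

Lemma inv_avg_finite B b e : small K B -> 0 < e ->
  exists F : set (mtuple M sx), [/\ finite_set F, F `<=` B &
    forall a a', conj_over F a a' -> `|inv_avg B b a - inv_avg B b a'| <= e].
Proof.
move=> sB e0; have [G [d [d0 hG]]] := inv_avg_separation b sB e0.
have [F [finF FB hF]] : exists F : set (mtuple M sx), [/\ finite_set F, F `<=` B &
    forall chi, List.In chi G -> forall a a', conj_over F a a' -> peval chi a = peval chi a'].
  elim: (G) => [|chi l [F [finF FB hF]]]; first by exists set0; split.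
  have [F' [finF' FB' hF']] := peval_finite_parameters chi.
  exists (F `|` F'); split; first by rewrite finite_setU.
    by move=> c [/FB|/FB'].
  move=> chi' [<-|/hF h] a a' aa'.
    by apply: hF'; apply: conj_sub aa' => c; right.
  by apply: h; apply: conj_sub aa' => c; left.
exists F; split => // a a' aa'; apply: hG => chi chiG.
by rewrite (hF _ chiG _ _ aa') subrr normr0 ltW.
Qed.

Lemma inv_avg_finite_sub B b e : small K B -> 0 < e ->
  exists F : set (mtuple M sx), [/\ finite_set F, F `<=` B &
    forall B0, F `<=` B0 -> B0 `<=` B ->
      forall a, `|inv_avg B0 b a - inv_avg B b a| <= e].
Proof.
move=> sB e0; have [F [finF FB hF]] := inv_avg_finite b sB e0.
exists F; split => // B0 FB0 B0B; apply: inv_avg_sub => // a a' aa'.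
by apply: hF; apply: conj_sub aa'.
Qed.

(** Otherwise there is a growing sequence of finite sets, each step changing the predicate by more
    than [e / 2] somewhere. But for their union, which is countable and so small, a finite subset
    settles the predicate up to [e / 4], and it lies in some member of the sequence. *)
Lemma inv_avg_almost_stationary (X : set (mtuple M sx)) b e : 0 < e ->
  exists F : set (mtuple M sx), [/\ finite_set F, F `<=` X &
    forall B, F `<=` B -> B `<=` X -> small K B ->
      forall a, `|inv_avg B b a - inv_avg F b a| <= e].
Proof.
move=> e0; apply: contrapT => H.
pose good (F : set (mtuple M sx)) := finite_set F /\ F `<=` X.
have e20 : 0 < e / 2 by rewrite divr_gt0.
have e40 : 0 < e / 4 by rewrite divr_gt0.
have step F : good F -> exists F', [/\ good F', F `<=` F' &
    exists a, e / 2 < `|inv_avg F' b a - inv_avg F b a|].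
  move=> [finF FX]; apply: contrapT => H'; apply: H; exists F; split => // B FB BX sB a.
  (* A small [B] that moves the predicate by more than [e] can be replaced by [F] together with a
     finite part of [B], at a loss of [e / 2]. *)
  have [F0 [finF0 F0B hF0]] := inv_avg_finite_sub b sB e20.
  rewrite leNgt; apply/negP => ha; apply: H'; exists (F `|` F0); split.
  - split; first by rewrite finite_setU.
    by move=> c [/FX//|/F0B/BX].
  - by move=> c; left.
  - exists a; have := hF0 (F `|` F0) (fun c h => or_intror h) _ a.
    have FF0B : F `|` F0 `<=` B by move=> c [/FB|/F0B].
    move=> /(_ FF0B) h; rewrite ltNge; apply/negP => h'; move: ha.
    rewrite ltNge => /negP; apply; move: h h'; rewrite !ler_norml.
    by move=> /andP[? ?] /andP[? ?]; lra.
have g0 : good set0 by split.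
pose stp (F : {F | good F}) := cid (step (sval F) (svalP F)).
have stpP F : good (sval (stp F)) by have [] := svalP (stp F).
pose S := fix S k : {F | good F} :=
  if k is k'.+1 then exist _ (sval (stp (S k'))) (stpP (S k')) else exist _ set0 g0.
pose F k := sval (S k).
have FS k : F k `<=` F k.+1 by have [] := svalP (stp (S k)).
have Fgap k : exists a, e / 2 < `|inv_avg (F k.+1) b a - inv_avg (F k) b a|.
  by have [] := svalP (stp (S k)).
have Fle k l : (k <= l)%N -> F k `<=` F l.
  elim: l => [|l IH]; first by rewrite leqn0 => /eqP ->.
  rewrite leq_eqVlt => /orP[/eqP -> //|/IH h]; exact: subset_trans h (FS l).
pose B := \bigcup_k F k.
have sB : small K B.
  apply: countable_small => //; apply: bigcup_countable => // k _.
  by apply: finite_set_countable; have [] := svalP (S k).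
have [G [/finite_set_list[s Gs] GB hG]] := inv_avg_finite_sub b sB e40.
have /choice[h hh] : forall c : mtuple M sx, exists k, G c -> F k c.
  move=> c; have [/GB[k _ Fkc]|nGc] := pselect (G c); first by exists k.
  by exists 0%N.
have [k hk] := list_bounded s h.
have GF l : (k <= l)%N -> G `<=` F l.
  move=> kl c /[dup] Gc /Gs/hk hc; apply: (Fle (h c)); last exact: hh.
  by apply: leq_trans kl; exact: ltnW.
have FB l : F l `<=` B by move=> c Flc; exists l.
have [a ha] := Fgap k.
have h1 := hG _ (GF k (leqnn _)) (FB k) a.
have h2 := hG _ (GF k.+1 (leqnSn _)) (FB k.+1) a.
move: ha; rewrite ltNge => /negP; apply; move: h1 h2; rewrite !ler_norml.
by move=> /andP[? ?] /andP[? ?]; lra.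
Qed.

(** [B] collects finite sets good for the errors [k.+1%:R^-1]; the predicates of [B] and of a small
    [B'] between [B] and [X] are both close to that of the same finite set. *)
Lemma inv_avg_stationary (X : set (mtuple M sx)) b :
  exists B : set (mtuple M sx), [/\ B `<=` X, countable B &
    forall B', B `<=` B' -> B' `<=` X -> small K B' ->
      inv_avg B' b = inv_avg B b].
Proof.
have /choice[F hF] : forall k : nat, exists F : set (mtuple M sx),
    [/\ finite_set F, F `<=` X & forall B, F `<=` B -> B `<=` X -> small K B ->
      forall a, `|inv_avg B b a - inv_avg F b a| <= k.+1%:R^-1].
  by move=> k; apply: inv_avg_almost_stationary.
pose B := \bigcup_k F k.
have FB k : F k `<=` B by move=> c Fkc; exists k.
have BX : B `<=` X by move=> c [k _]; have [_ + _] := hF k; apply.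
have cB : countable B.
  by apply: bigcup_countable => // k _; apply: finite_set_countable; have [] := hF k.
exists B; split => // B' BB' B'X sB'; apply/funext => a.
apply/eqP; rewrite -subr_eq0 -normr_le0; apply/ler_addgt0Pr => d d0; rewrite add0r.
have d30 : 0 < d / 2 by rewrite divr_gt0.
have [k hk] := invS_le d30.
have [_ _ h] := hF k.
have h1 := le_trans (h B' (subset_trans (FB k) BB') B'X sB' a) hk.
have h2 := le_trans (h B (FB k) BX (countable_small sN cB) a) hk.
by move: h1 h2; rewrite !ler_norml => /andP[? ?] /andP[? ?]; lra.
Qed.

End InvariantAverage.

(** * Definability *)

Section InfConvolution.
Context {R : realType} {P : Type} (p0 : P) {N : nat}.
Variables (psi : P -> R) (chi : 'I_N -> P -> R) (C : R).
Hypotheses (psi01 : forall a, 0 <= psi a <= 1) (C0 : 0 <= C).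

Lemma inf_dist (u v : P -> R) (e : R) : (forall a, 0 <= u a) -> (forall a, 0 <= v a) ->
  (forall a, `|u a - v a| <= e) -> `|inf (range u) - inf (range v)| <= e.
Proof.
have half (u' v' : P -> R) : (forall a, 0 <= u' a) -> (forall a, `|u' a - v' a| <= e) ->
    inf (range u') <= inf (range v') + e.
  move=> u0 uv; rewrite -lerBlDr; apply: lb_le_inf; first by exists (v' p0); exists p0.
  move=> _ [a _ <-]; rewrite lerBlDr; apply: le_trans (_ : u' a <= _).
    by apply: ge_inf; [exists 0 => _ [a' _ <-]|exists a].
  by have := uv a; rewrite ler_norml; lra.
move=> u0 v0 uv; have h1 := half u v u0 uv.
have h2 := half v u v0 (fun a => ltac:(by rewrite distrC; exact: uv)).
by rewrite ler_norml; lra.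
Qed.

(** The infimal convolution of Lipschitz extension: its infimum over [a] is a Lipschitz function,
    hence a connective, of the values of the [chi i], and it recovers [psi] up to an error. *)
Definition infconv_term (t : 'I_N -> R) a := Num.min 1 (psi a + C * \sum_i `|t i - chi i a|).
Definition infconv (t : 'I_N -> R) := inf (range (infconv_term t)).

Lemma infconv_term_ge0 t a : 0 <= infconv_term t a.
Proof.
rewrite le_min ler01 /= addr_ge0//; first by have /andP[] := psi01 a.
by rewrite mulr_ge0// sumr_ge0.
Qed.

Lemma infconv_lipschitz t t' : `|infconv t - infconv t'| <= C * \sum_i `|t i - t' i|.
Proof.
apply: inf_dist => [a|a|a]; try exact: infconv_term_ge0.
apply: le_trans (dist_min1 _ _) _.
rewrite opprD addrACA subrr add0r -mulrBr normrM (ger0_norm C0) ler_wpM2l//.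
rewrite -sumrB; apply: le_trans (ler_norm_sum _ _ _) _; apply: ler_sum => i _.
by apply: le_trans (ler_dist_dist _ _) _; rewrite opprB addrA subrK.
Qed.

Lemma infconv_range t : 0 <= infconv t <= 1.
Proof.
apply/andP; split.
  apply: lb_le_inf; first by exists (infconv_term t p0); exists p0.
  by move=> _ [a _ <-]; exact: infconv_term_ge0.
apply: le_trans (_ : infconv_term t p0 <= _); last by rewrite ge_min lexx.
by apply: ge_inf; [exists 0 => _ [a _ <-]; exact: infconv_term_ge0|exists p0].
Qed.

(** The point [a] itself gives the upper bound. For the lower one, [a'] either is within [C^-1] of
    [a], where [psi] varies by at most [e], or pays a penalty of at least 1. *)
Lemma infconv_approx (e : R) a : 0 <= e ->
  (forall a', (forall i, `|chi i a - chi i a'| <= C^-1) -> `|psi a - psi a'| <= e) ->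
  0 < C -> `|psi a - infconv (fun i => chi i a)| <= e.
Proof.
move=> e0 he Cp; have h1 : infconv (fun i => chi i a) <= psi a.
  apply: le_trans (_ : infconv_term (fun i => chi i a) a <= _).
    by apply: ge_inf; [exists 0 => _ [a' _ <-]; exact: infconv_term_ge0|exists a].
  rewrite ge_min; apply/orP; right.
  by rewrite big1 ?mulr0 ?addr0// => i _; rewrite subrr normr0.
have h2 : psi a - e <= infconv (fun i => chi i a).
  apply: lb_le_inf; first by exists (infconv_term (fun i => chi i a) p0); exists p0.
  move=> _ [a' _ <-]; rewrite le_min; have /andP[p1 p2] := psi01 a.
  have /andP[q1 q2] := psi01 a'.
  apply/andP; split; first by lra.
  have [h|h] := lerP (\sum_i `|chi i a - chi i a'|) C^-1.
    have : `|psi a - psi a'| <= e.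
      apply: he => i; apply: le_trans h.
      by rewrite (bigD1 i)//= lerDl sumr_ge0.
    have : 0 <= C * \sum_i `|chi i a - chi i a'| by rewrite mulr_ge0// sumr_ge0.
    by rewrite ler_norml; lra.
  have : 1 <= C * \sum_i `|chi i a - chi i a'|.
    by rewrite mulrC -ler_pdivrMr// div1r ltW.
  by lra.
by rewrite ler_norml; lra.
Qed.

End InfConvolution.

(** [inv_avg_separation] controls the variation of the predicate by that of finitely many formulas;
    with the constant [d^-1] the penalty in [infconv] reaches 1 at distance [d]. *)
Lemma inv_avg_formula (R : realType) (L : language R) (T : set (sentence L)) (K : Type)
    (M : structure L) (hM : monster K M T) n m (sx : 'I_n -> lsort L) (sy : 'I_m -> lsort L)
    (phi : formula (ctx_sum sx sy)) (hphi : stable T phi) (B : set (mtuple M sx))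
    (b : mtuple M sy) (e : R) : small K B -> 0 < e ->
  exists chi : pformula (coords B) sx, forall a, `|inv_avg phi B b a - peval chi a| <= e.
Proof.
move=> sB e0; have [F [d [d0 hF]]] := inv_avg_separation hM hphi b sB e0.
have inh j : exists x : M (sx j), True by have [x] := carrier_inh M (sx j); exists x.
pose a0 : mtuple M sx := fun j => sval (cid (inh j)).
have dV0 : 0 < d^-1 by rewrite invr_gt0.
pose chi (i : 'I_(size F)) : pformula (coords B) sx := tnth (in_tuple F) i.
have H := inv_avg_range hM hphi B b.
pose c := lipschitz_connective
  (infconv_lipschitz a0 (fun i => peval (chi i)) H (ltW dV0))
  (fun x _ => infconv_range a0 (fun i => peval (chi i)) H (ltW dV0) x).
exists (Conn c chi) => a.
apply: (infconv_approx a0 (chi := fun i => peval (chi i)) H (ltW dV0) (ltW e0)) => // a' ha'.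
apply: hF => psi /[dup] psiF; rewrite invrK in ha'.
move=> /(In_nth psi)[i iF ->].
by have := ha' (Ordinal iF); rewrite /chi (tnth_nth psi).
Qed.

Lemma uniform_limit_definable (R : realType) (L : language R) (M : structure L)
    (A : set (elt M)) V (sv : V -> lsort L) (psi : mtuple M sv -> R) :
  (forall e, 0 < e -> exists chi : pformula A sv, forall a, `|psi a - peval chi a| <= e) ->
  definable_predicate A psi.
Proof.
move=> h.
have /choice[chi hchi] : forall k : nat, exists chi : pformula A sv,
    forall a, `|psi a - peval chi a| <= k.+1%:R^-1.
  by move=> k; apply: h.
exists chi => W /uniform_nbhs[E [/= entE EW]].
have [e /= e0 he] := entE.
have [k hk] := invS_le (divr_gt0 e0 (ltr0Sn R 1)).
exists k => // l /= kl; apply: EW => a _; apply: he; rewrite /ball_ /=.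
apply: le_lt_trans (hchi l a) _.
apply: le_lt_trans (_ : k.+1%:R^-1 < _).
  by rewrite lef_pV2 ?posrE ?ltr0n// ler_nat.
by apply: le_lt_trans hk _; rewrite ltr_pdivrMr//; lra.
Qed.

(** * Forced limits *)

Section ForcedLimit.
Context {R : realType} (N : nat -> nat).
Hypothesis N0 : forall k, (0 < N k)%N.
Implicit Types x y : nat * nat -> R.

(** Families of various lengths [N k] are the rows of one array, so that a single index set serves;
    entries beyond [N k] are ignored. *)
Definition row_avg x k : R := (\sum_(j < N k) x (k, nat_of_ord j)) / (N k)%:R.

Definition clamp (u e v : R) := Num.max (u - e) (Num.min (u + e) v).

(** Each row average is followed only as far as [2 ^- k'] allows, so the sequence converges at a
    fixed rate whatever the input is; this makes the limit continuous on the whole product. *)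
Fixpoint forced x k : R :=
  if k is k'.+1 then clamp (forced x k') (2 ^- k') (row_avg x k) else row_avg x 0%N.

Lemma clampP (u e v : R) : 0 <= e -> [/\ `|clamp u e v - u| <= e,
  Num.min u v <= clamp u e v <= Num.max u v & (`|v - u| <= e -> clamp u e v = v)].
Proof.
move=> e0; rewrite /clamp /Order.max /Order.min.
case: (ltP (u + e) v) => h1; case: (ltP u v) => h2.
all: case: (ltP _ _) => h3; split; rewrite ?ler_norml; try lra.
all: by move=> h; lra.
Qed.

Lemma clamp_dist (u e v u' v' d : R) : `|u - u'| <= d -> `|v - v'| <= d ->
  `|clamp u e v - clamp u' e v'| <= d.
Proof.
rewrite /clamp /Order.max /Order.min !ler_norml => /andP[h1 h2] /andP[h3 h4].
case: (ltP (u + e) v) => ?; case: (ltP (u' + e) v') => ?.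
all: case: (ltP (u - e) _) => ?; case: (ltP (u' - e) _) => ?; lra.
Qed.

Let p0 k : 0 < 2 ^- k :> R.
Proof. by rewrite invr_gt0 exprn_gt0. Qed.

Let pS k : 2 ^- k.+1 = 2 ^- k / 2 :> R.
Proof. by rewrite exprS invfM mulrC. Qed.

Lemma forced_tail x k l : (k <= l)%N -> `|forced x l - forced x k| <= 2 * 2 ^- k - 2 * 2 ^- l.
Proof.
elim: l => [|l IH]; first by rewrite leqn0 => /eqP ->; rewrite !subrr normr0.
rewrite leq_eqVlt => /orP[/eqP -> |/IH h]; first by rewrite !subrr normr0.
have [+ _ _] := clampP (forced x l) (row_avg x l.+1) (ltW (p0 l)).
move: h; rewrite [forced x l.+1]/= pS !ler_norml => /andP[? ?] /andP[? ?]; lra.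
Qed.

(** The limit of the sequence: by [forced_tail], the terms shifted by the remaining error decrease
    to it. *)
Definition forced_lim x := inf (range (fun k => forced x k + 2 * 2 ^- k)).

Lemma forced_lim_dist x k : `|forced_lim x - forced x k| <= 2 * 2 ^- k.
Proof.
have lo l : forced x k - 2 * 2 ^- k <= forced x l + 2 * 2 ^- l.
  have [kl|/ltnW lk] := leqP k l.
    have := forced_tail x kl; have := p0 l; rewrite ler_norml => ? /andP[? ?]; lra.
  have := forced_tail x lk; have := p0 k; rewrite ler_norml => ? /andP[? ?]; lra.
rewrite ler_norml lerBlDl lerBrDl; apply/andP; split.
  apply: lb_le_inf; first by exists (forced x 0 + 2 * 2 ^- 0); exists 0%N.
  by move=> _ [l _ <-]; exact: lo.
apply: ge_inf; last by exists k.
by exists (forced x k - 2 * 2 ^- k) => _ [l _ <-]; exact: lo.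
Qed.

Lemma pow2N_lt (e : R) : 0 < e -> exists k, 2 * 2 ^- k <= e.
Proof.
move=> e0; have [k hk] := invS_le (divr_gt0 e0 (ltr0Sn R 1)).
exists k; rewrite mulrC -ler_pdivlMr//; apply: le_trans hk.
rewrite lef_pV2 ?posrE ?exprn_gt0 ?ltr0n// -natrX ler_nat; exact: ltn_expl.
Qed.

(** Neither averaging nor clamping leaves an interval that contains the entries; faithfulness rests
    on this. *)
Lemma forced_lim_bounds x lo hi : (forall i, lo <= x i <= hi) -> lo <= forced_lim x <= hi.
Proof.
move=> xb; have rb k : lo <= row_avg x k <= hi.
  have n0 : 0 < (N k)%:R :> R by rewrite ltr0n.
  rewrite /row_avg ler_pdivlMr// ler_pdivrMr//.
  have cE c : c * (N k)%:R = \sum_(j < N k) c by rewrite sumr_const card_ord mulr_natr.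
  rewrite !cE; apply/andP; split; apply: ler_sum => j _;
    by have /andP[] := xb (k, nat_of_ord j).
have fb k : lo <= forced x k <= hi.
  elim: k => [|k /andP[h1 h2]]; first exact: rb.
  have [_ + _] := clampP (forced x k) (row_avg x k.+1) (ltW (p0 k)).
  have /andP[h3 h4] := rb k.+1.
  move=> /andP[h5 h6]; apply/andP; split; [apply: le_trans h5|apply: le_trans h6 _].
    by rewrite le_min h1.
  by rewrite ge_max h2.
apply/andP; split; apply/ler_addgt0Pr => d /pow2N_lt[k hk].
  by have := forced_lim_dist x k; have := fb k; rewrite ler_norml => /andP[? ?] /andP[? ?]; lra.
by have := forced_lim_dist x k; have := fb k; rewrite ler_norml => /andP[? ?] /andP[? ?]; lra.
Qed.

(** Consecutive row averages differ by at most [2 ^- k.+1 + 2 ^- k.+2], which is below [2 ^- k], so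
    no clamp ever acts. *)
Lemma forced_lim_eq x l : (forall k, `|l - row_avg x k| <= 2 ^- k.+1) -> forced_lim x = l.
Proof.
move=> h; have fE k : forced x k = row_avg x k.
  elim: k => [//|k IH].
  have [_ _ ] := clampP (forced x k) (row_avg x k.+1) (ltW (p0 k)); apply.
  have := h k; have := h k.+1; have := p0 k; rewrite IH !pS !ler_norml.
  by move=> ? /andP[? ?] /andP[? ?]; lra.
apply/eqP; rewrite -subr_eq0 -normr_le0; apply/ler_addgt0Pr => d d0.
have [k hk] := pow2N_lt (divr_gt0 d0 (ltr0Sn R 1)).
have := forced_lim_dist x k; have := h k; have := p0 k.
rewrite fE pS !ler_norml => ? /andP[? ?] /andP[? ?]; lra.
Qed.

Local Notation near_cont F := (forall (x : {ptws (nat * nat)%type -> R}) (e : R), 0 < e ->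
  \forall y \near nbhs x, `|F x - F y| <= e).

Lemma row_avg_continuous k : near_cont (fun x => row_avg x k).
Proof.
move=> x e e0.
have hn : \forall y \near nbhs x, forall j : 'I_(N k), `|x (k, nat_of_ord j) - y (k, nat_of_ord j)| <= e.
  apply: filter_forall => j.
  have /(@cvgrPdist_le R R^o {ptws (nat * nat)%type -> R} (nbhs x) _
    (fun y => y (k, nat_of_ord j)) (x (k, nat_of_ord j))) :=
    @proj_continuous _ (fun=> R) (k, nat_of_ord j) x.
  by move/(_ e e0).
apply: (@filterS _ (nbhs x) _ _ _ _ hn) => y hy.
have n0 : 0 < (N k)%:R :> R by rewrite ltr0n.
rewrite /row_avg -mulrBl normrM [`|_^-1|]ger0_norm ?invr_ge0 ?(ltW n0)// ler_pdivrMr//.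
rewrite -sumrB; apply: le_trans (ler_norm_sum _ _ _) _.
rewrite mulr_natr -[X in _ *+ X]card_ord -sumr_const; apply: ler_sum => j _; exact: hy.
Qed.

Lemma forced_continuous k : near_cont (fun x => forced x k).
Proof.
elim: k => [|k IH] x e e0; first exact: row_avg_continuous.
have h : \forall y \near nbhs x, `|forced x k - forced y k| <= e /\
    `|row_avg x k.+1 - row_avg y k.+1| <= e.
  exact: (@filterI _ (nbhs x) _ _ _ (IH x e e0) (@row_avg_continuous k.+1 x e e0)).
apply: (@filterS _ (nbhs x) _ _ _ _ h) => y [h1 h2]; exact: clamp_dist.
Qed.

Lemma forced_lim_continuous :
  continuous (forced_lim : {ptws (nat * nat)%type -> R} -> R).
Proof.
move=> x.
apply/(@cvgrPdist_le R R^o {ptws (nat * nat)%type -> R} (nbhs x) _ forced_lim (forced_lim x)).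
move=> e e0; have e30 : 0 < e / 3 by rewrite divr_gt0.
have [k hk] := pow2N_lt e30.
apply: (@filterS _ (nbhs x) _ _ _ _ (@forced_continuous k x _ e30)) => y hy.
have := forced_lim_dist x k; have := forced_lim_dist y k; move: hy.
rewrite !ler_norml => /andP[? ?] /andP[? ?] /andP[? ?]; lra.
Qed.

Definition forced_connective : connective R (nat * nat) :=
  @Connective R (nat * nat) forced_lim (continuous_subspaceT forced_lim_continuous)
    (fun x hx => forced_lim_bounds hx).

Lemma forced_connective_faithful : faithful forced_connective.
Proof.
split; first exact: (inhabits (0%N, 0%N)).
move=> x hx; apply: forced_lim_bounds => i.
rewrite ge_inf/=; first by apply: ub_le_sup; [exists 1 => _ [j _ <-]; have /andP[] := hx j|exists i].
  by exists 0 => _ [j _ <-]; have /andP[] := hx j.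
by exists i.
Qed.

End ForcedLimit.

(** The rows are approximately invariant families with errors [2 ^- k.+1], the rate at which
    [forced_lim_eq] returns the limit of their averages. *)
Lemma inv_avg_faithful (R : realType) (L : language R) (T : set (sentence L)) (K : Type)
    (M : structure L) (hM : monster K M T) n m (sx : 'I_n -> lsort L) (sy : 'I_m -> lsort L)
    (phi : formula (ctx_sum sx sy)) (hphi : stable T phi) (B : set (mtuple M sx))
    (b : mtuple M sy) :
  faithful_combination [set instance phi b' | b' in conj_over B b] (inv_avg phi B b).
Proof.
have p0 k : 0 < 2 ^- k.+1 :> R by rewrite invr_gt0 exprn_gt0.
have /choice[s hs] : forall k, exists s, approx_invariant (value phi) B b (2 ^- k.+1) s.
  by move=> k; exact: approx_invariant_exists (value_range phi) (value_act phi)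
    (value_no_ladder hM hphi) (p0 k).
pose N k := size (s k).
have N0 k : (0 < N k)%N by have [] := hs k.
exists (nat * nat)%type, (forced_connective N0),
  (fun i => instance phi (nth b (s i.1) i.2)); split.
- exact: forced_connective_faithful.
- move=> [k j] /=; exists (nth b (s k) j) => //.
  (* Beyond the end of a row the default is [b], which is conjugate to itself. *)
  have [jN|jN] := ltnP j (size (s k)); last by rewrite nth_default//; exact: conj_refl.
  by have [_ h _] := hs k; apply: h; exact: nth_In.
- move=> a; symmetry; apply: forced_lim_eq => // k.
  have := inv_avg_dist hM hphi a (p0 k) (hs k).
  suff -> : avg (value phi a) (s k) =
    row_avg N (fun i => instance phi (nth b (s i.1) i.2) a) k by [].
  by rewrite /avg /row_avg (big_nth b) big_mkord.
Qed.

Lemma faithful_combinationS (R : realType) (L : language R) (M : structure L)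
    V (sv : V -> lsort L) (F G : set (mtuple M sv -> R)) psi :
  F `<=` G -> faithful_combination F psi -> faithful_combination G psi.
Proof.
by move=> FG [I [theta [f [ft Ff e]]]]; exists I, theta, f; split => // i; exact: FG.
Qed.

Theorem theorem2p16 (R : realType) (L : language R) (T : set (sentence L))
    (K : Type) (M : structure L) (hM : monster K M T)
    (n m : nat) (sx : 'I_n -> lsort L) (sy : 'I_m -> lsort L)
    (phi : formula (ctx_sum sx sy)) (hphi : stable T phi)
    (b : mtuple M sy)
    (A : set (elt M)) (hA : small K A)
    (X : set (mtuple M sx)) (hX : type_definable A X) :
  exists B : set (mtuple M sx),
    [/\ B `<=` X, countable B,
        exists psi : mtuple M sx -> R,
          [/\ definable_predicate (coords B) psi,
              forall a, X a -> psi a = instance phi b a &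
              faithful_combination
                [set instance phi b' | b' in equiv_over (coords B) b] psi] &
        forall B' : set (mtuple M sx), B' `<=` X -> small K B' ->
          exists psi : mtuple M sx -> R,
            [/\ definable_predicate (coords B) psi,
                forall a, X a -> psi a = instance phi b a &
                faithful_combination
                  [set instance phi b' | b' in equiv_over (coords B') b] psi]].
Proof.
have [B [BX cB hB]] := inv_avg_stationary hM hphi X b.
have sN := monster_uncountable hM.
have sB : small K B := countable_small sN cB.
have main (B' : set (mtuple M sx)) : B' `<=` X -> small K B' ->
    exists psi : mtuple M sx -> R,
      [/\ definable_predicate (coords B) psi,
          forall a, X a -> psi a = instance phi b a &
          faithful_combination
            [set instance phi b' | b' in equiv_over (coords B') b] psi].
  (* One predicate serves for every [B']; only its representation as a faithful combination depends
     on [B']. *)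
  move=> B'X sB'; exists (inv_avg phi B b); split.
  - by apply: uniform_limit_definable => e e0; exact: (inv_avg_formula hM hphi).
  - move=> a Xa; rewrite -(hB (B `|` [set a])).
    + by apply: (inv_avg_mem hM hphi); right.
    + by move=> c; left.
    + by move=> c [/BX|->].
    + apply: countable_small => //.
      by rewrite -bigcup2E; apply: bigcup_countable => // -[|[|i]] _ //=; exact: countable0.
  - have sBB' : small K (B `|` B').
      have /countable_injP[h hinj] := cB.
      apply: (@small_coded K _ _ B' _ (fun o k c => match o with
        | Some c' => c = c' | None => B c /\ h c = k end)) => //.
      * case=> [c'|] k c d; first by move=> -> ->.
        by move=> [Bc <-] [Bd /hinj dc]; symmetry; apply: dc; rewrite inE.
      * move=> c [Bc|B'c]; first by exists None, (h c).
        by exists (Some c), 0%N; split => // d [<-].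
    (* Over the union of [B] and [B'] the predicate is the same, and conjugates of [b] over the
       union are equivalent to [b] over [B']. *)
    rewrite -(hB (B `|` B')) //.
    + apply: faithful_combinationS (inv_avg_faithful hM hphi (B `|` B') b).
      move=> _ [b' bb' <-]; exists b' => //.
      by apply: conj_equiv; apply: conj_sub bb' => c; right.
    + by move=> c [/BX|/B'X].
(* [main] is used for [B] itself and for arbitrary small [B']. *)
by exists B; split => //; exact: main.
Qed.
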